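(* Let $h_{\alpha_1,\alpha_2,\pi_1}$ and $h_{\beta_1,\beta_2,\pi_2}$ be two simple elements such that $$\phi=(\alpha_2+(\alpha_1-\alpha_2)\pi_1)-(\beta_2+(\beta_1-\beta_2)\pi_2)$$ is invertible, and set $\tau_i=\phi\pi_i\phi^{-1}$ for $i=1,2$. Let $u$ be a local solution (near $(0,0)$) of the $j$-th flow in the $sl(n,\mathbb C)$-hierarchy which admits a local reduced wave function. Let $$u_1=h_{\alpha_1,\alpha_2,\pi_1}*u=u+(\alpha_1-\alpha_2)[a,\tilde\pi_1],\qquad u_2=h_{\beta_1,\beta_2,\pi_2}*u=u+(\beta_1-\beta_2)[a,\tilde\pi_2],$$ and set $\tilde\tau_i=\tilde\phi\tilde\pi_i\tilde\phi^{-1}$, where $$\tilde\phi=(\alpha_2+(\alpha_1-\alpha_2)\tilde\pi_1)-(\beta_2+(\beta_1-\beta_2)\tilde\pi_2).$$ Then, on a neighbourhood of $(0,0)$, $$u_3:=h_{\alpha_1,\alpha_2,\tau_1}*u_2=u_2+(\alpha_1-\alpha_2)[a,\tilde\tau_1]=h_{\beta_1,\beta_2,\tau_2}*u_1=u_1+(\beta_1-\beta_2)[a,\tilde\tau_2].$$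
   Context: Fix a nonzero diagonal $a\in sl(n,\mathbb C)$ with diagonal entries $a_i$, $b$ a polynomial in $a$, and $j\ge1$. $sl(n)_a^\perp$ is the orthogonal complement (trace form) of the centralizer of $a$ in $sl(n,\mathbb C)$. For smooth $u$ with values in $sl(n)_a^\perp$: $Q_{b,0}(u)=b$, and $Q_{b,k}(u)$, $k\ge1$, are the unique matrix-valued polynomials without constant term in the entries of $u$ and their $x$-derivatives such that $(Q_{b,k}(u))_x+[u,Q_{b,k}(u)]=[Q_{b,k+1}(u),a]$ for all $k\ge0$. The $j$-th flow is $u_t=(Q_{b,j}(u))_x+[u,Q_{b,j}(u)]$ for $sl(n)_a^\perp$-valued $u$. The trivialization $E(x,t,\lambda)$ of a solution $u$ solves $E_x=E(a\lambda+u)$, $E_t=E(b\lambda^j+Q_{b,1}(u)\lambda^{j-1}+\dots+Q_{b,j}(u))$, $E(0,0,\lambda)=I$. A local reduced wave function of $u$ is a smooth $GL(n,\mathbb C)$-valued $m(x,t,\lambda)$ (away from poles), meromorphic in $\lambda\in\mathbb C\setminus\Gamma_a$, where $\Gamma_a=\{\lambda:\mathrm{Re}(\lambda(a_i-a_k))=0\text{ for some }a_i\ne a_k\}$, with asymptotic expansion $I+m_1\lambda^{-1}+\cdots$ at $\lambda=\infty$, $u=[a,m_1]$, and $E=m(0,0,\lambda)^{-1}e^{a\lambda x+b\lambda^jt}m(x,t,\lambda)$. For $\alpha_1,\alpha_2\in\mathbb C$ and a complex linear projection $\pi$ of $\mathbb C^n$ ($\pi^2=\pi$) with $V_1=\mathrm{Im}\,\pi$,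 $V_2=\mathrm{Im}(I-\pi)$, the simple element is $h_{\alpha_1,\alpha_2,\pi}(\lambda)=I+\frac{\alpha_1-\alpha_2}{\lambda-\alpha_1}(I-\pi)$. On a neighbourhood of $(0,0)$ where $\tilde V_i(x,t)=E(x,t,\alpha_i)^{-1}(V_i)$ satisfy $\tilde V_1\cap\tilde V_2=0$, one defines $h_{\alpha_1,\alpha_2,\pi}*u=u+(\alpha_1-\alpha_2)[a,\tilde\pi]$, with $\tilde\pi(x,t)$ the projection onto $\tilde V_1(x,t)$ along $\tilde V_2(x,t)$; this is again a local solution of the $j$-th flow admitting a local reduced wave function. In the claim $\tilde\pi_1$ is obtained this way from $(\alpha_1,\alpha_2,\pi_1)$ and $\tilde\pi_2$ from $(\beta_1,\beta_2,\pi_2)$, both using the trivialization of $u$. *)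

(* Defs.v *)
From HB Require Import structures.
From mathcomp Require Import all_boot all_order all_algebra.
From mathcomp Require Import complex.
From mathcomp Require Import all_classical all_reals all_analysis.
From mathcomp Require mpoly.

Set Implicit Arguments.
Unset Strict Implicit.
Unset Printing Implicit Defensive.

Import Order.TTheory GRing.Theory Num.Theory numFieldNormedType.Exports.

Local Open Scope classical_set_scope.
Local Open Scope ring_scope.
Local Open Scope complex_scope.

(* The size of the matrices is written n.+1, so that 'M_n.+1 is a ring and
   horner_mx applies; a 0 x 0 matrix is never nonzero.  Functions of (x, t)
   are functions on R * R; a local object is a total function that is only
   constrained on an open set O containing (0, 0).  *)

Section Smoothness.
Context {R : realType}.

(* C^k on the open set A: all iterated derivatives up to order k along the
   directions in dirs exist and are continuous on A.  With the coordinate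
   directions for dirs these are the iterated partial derivatives. *)
Fixpoint Ck_on {V : normedModType R} (dirs : seq V) (A : set V) (k : nat)
    (f : V -> R) : Prop :=
  (forall z, A z -> {for z, continuous f}) /\
  match k with
  | 0%N => True
  | k'.+1 => forall v, v \in dirs ->
      (forall z, A z -> derivable f z v) /\ Ck_on dirs A k' ('D_v f)
  end.

Definition smooth_on {V : normedModType R} (dirs : seq V) (A : set V)
    (f : V -> R) : Prop :=
  forall k, Ck_on dirs A k f.

Definition smooth_mx_on {V : normedModType R} {n : nat} (dirs : seq V)
    (A : set V) (F : V -> 'M[R[i]]_n) : Prop :=
  forall i j, smooth_on dirs A (fun z => complex.Re (F z i j)) /\
              smooth_on dirs A (fun z => complex.Im (F z i j)).

Definition dir_x : R * R := (1, 0).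
Definition dir_t : R * R := (0, 1).

Definition xt_dirs : seq (R * R) := [:: dir_x; dir_t].

(* coordinate directions of the (x, t, Re lambda, Im lambda)-space *)
Definition xtl_dirs : seq ((R * R) * (R * R)) :=
  [:: (dir_x, 0); (dir_t, 0); (0, dir_x); (0, dir_t)].

Definition pderiv {n : nat} (v : R * R) (F : R * R -> 'M[R[i]]_n)
    (z : R * R) : 'M[R[i]]_n :=
  \matrix_(i, j) ('D_v (fun w => complex.Re (F w i j)) z +i*
                  'D_v (fun w => complex.Im (F w i j)) z).

End Smoothness.

Definition lie {K : pzRingType} {n : nat} (A B : 'M[K]_n) : 'M[K]_n :=
  A *m B - B *m A.

(* orthogonal complement, in sl and for the trace form, of the centralizer
   of a in sl *)
Definition sl_perp {K : pzRingType} {n : nat} (a X : 'M[K]_n) : Prop :=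
  \tr X = 0 /\
  forall Y : 'M[K]_n, \tr Y = 0 -> lie a Y = 0 -> \tr (X *m Y) = 0.

Section Hierarchy.
Context {R : realType} {n : nat}.
Local Notation C := (R[i]).
Local Notation M := ('M[R[i]]_n.+1).
Implicit Types (a b : M) (O : set (R * R)) (u : R * R -> M).

Definition jet u (z : R * R) : nat -> M := fun k => iter k (pderiv dir_x) u z.

(* A polynomial in the entries of u and of its x-derivatives is seen as a
   function of the sequence J of matrices (u, u_x, u_xx, ...): it is given by
   a polynomial in finitely many of the entries J k i j. *)
Definition jet_polynomial (f : (nat -> M) -> C) : Prop :=
  exists (d : nat) (p : mpoly.mpoly d C) (v : 'I_d -> nat * 'I_n.+1 * 'I_n.+1),
    forall J : nat -> M,
      f J = mpoly.meval (fun l => J (v l).1.1 (v l).1.2 (v l).2) p.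

(* Q k represents Q_{b,k}: Q_{b,k}(u) at z is Q k (jet u z). *)
Record Q_sequence a b (Q : nat -> (nat -> M) -> M) : Prop := {
  Q_zero : forall J, Q 0%N J = b;
  Q_polynomial : forall k i j, jet_polynomial (fun J => Q k J i j);
  Q_no_constant_term : forall k, Q k.+1 (fun=> 0) = 0;
  Q_recursion : forall O u, open O -> smooth_mx_on xt_dirs O u ->
    (forall z, O z -> sl_perp a (u z)) ->
    forall k z, O z ->
      pderiv dir_x (fun w => Q k (jet u w)) z + lie (u z) (Q k (jet u z))
      = lie (Q k.+1 (jet u z)) a }.

Record flow_solution a (Q : nat -> (nat -> M) -> M) (j : nat) O u : Prop := {
  flow_smooth : smooth_mx_on xt_dirs O u;
  flow_perp : forall z, O z -> sl_perp a (u z);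
  flow_eq : forall z, O z ->
    pderiv dir_t u z =
      pderiv dir_x (fun w => Q j (jet u w)) z + lie (u z) (Q j (jet u z)) }.

(* The k = 0 term of the sum in triv_t is b lambda^j.  For connected O these
   conditions determine E on O. *)
Record trivialization a (Q : nat -> (nat -> M) -> M) (j : nat) O u
    (E : R * R -> C -> M) : Prop := {
  triv_smooth : forall l : C, smooth_mx_on xt_dirs O (fun z => E z l);
  triv_x : forall (l : C) z, O z ->
    pderiv dir_x (fun w => E w l) z = E z l *m (l *: a + u z);
  triv_t : forall (l : C) z, O z ->
    pderiv dir_t (fun w => E w l) z =
      E z l *m (\sum_(k < j.+1) l ^+ (j - k) *: Q k (jet u z));
  triv_0 : forall l : C, E (0, 0) l = 1%:M }.

Definition Gamma a : set C :=
  [set l | exists i k, a i i != a k k /\ complex.Re (l * (a i i - a k k)) = 0].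

(* entrywise limit of the partial sums of the exponential series *)
Definition expmx (A : M) : M :=
  let S := fun N : nat => \sum_(k < N) (k`!%:R : C)^-1 *: A ^+ k in
  \matrix_(i, j) (limn (fun N => complex.Re (S N i j)) +i*
                  limn (fun N => complex.Im (S N i j))).

(* m takes values in GL and is holomorphic in lambda outside Gamma and the
   set P, which is discrete and closed in the complement of Gamma and contains
   the poles of m and of its inverse.  P does not depend on (x, t): by
   rwf_factor neither do these poles, as E and the exponential are entire in
   lambda with entire inverses.  The coefficients of the asymptotic expansion
   are the mk k. *)
Record reduced_wave_function a b (j : nat) O u (E m : R * R -> C -> M)
    (P : set C) (mk : nat -> R * R -> M) : Prop := {
  rwf_discrete : forall p : C, ~ Gamma a p ->
    \forall l \near ((p : (R[i] : numFieldType))^'), ~ P l;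
  rwf_unit : forall z l, O z -> ~ Gamma a l -> ~ P l -> m z l \in unitmx;
  rwf_smooth :
    smooth_mx_on xtl_dirs
      [set w | O w.1 /\ ~ Gamma a (w.2.1 +i* w.2.2) /\ ~ P (w.2.1 +i* w.2.2)]
      (fun w => m w.1 (w.2.1 +i* w.2.2));
  rwf_holomorphic : forall z l, O z -> ~ Gamma a l -> ~ P l ->
    forall i k, derivable
      ((fun s => m z s i k) : (R[i] : numFieldType) -> (R[i] : numFieldType))
      l 1;
  rwf_meromorphic : forall z p, O z -> ~ Gamma a p -> P p ->
    forall i k, exists (d : nat) (c : C),
      (((s - p) ^+ d * m z s i k : (R[i] : numFieldType))
         @[s --> (p : (R[i] : numFieldType))^']) --> (c : (R[i] : numFieldType));
  rwf_expansion0 : forall z, O z -> mk 0%N z = 1%:M;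
  rwf_expansion : forall z (N : nat), O z -> exists K B : R,
    forall l : C, ~ Gamma a l -> ~ P l -> B%:C < `|l| -> forall i k,
      `|m z l i k - (\sum_(d < N.+1) l ^- d *: mk d z) i k|
        <= K%:C * `|l| ^- N.+1;
  rwf_u : forall z, O z -> u z = lie a (mk 1%N z);
  rwf_factor : forall z l, O z -> ~ Gamma a l -> ~ P l ->
    E z l = invmx (m (0, 0) l)
            *m expmx ((l * (z.1)%:C) *: a + (l ^+ j * (z.2)%:C) *: b)
            *m m z l }.

(* The simple element 1 + (al1 - al2) / (lambda - al1) (1 - p) is given by its
   data (al1, al2, p), p an idempotent matrix acting on column vectors.  (For
   al1 = al2 it does not determine p.)  mxalgebra works with row spaces, hence
   the transpositions: (moved1 E al1 p z)^T and (moved2 E al2 p z)^T have row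
   spaces E^-1 (Im p) and E^-1 (Im (1 - p)), with E taken at al1, resp. al2. *)
Definition moved1 (E : R * R -> C -> M) (al1 : C) (p : M) (z : R * R) : M :=
  invmx (E z al1) *m p.

Definition moved2 (E : R * R -> C -> M) (al2 : C) (p : M) (z : R * R) : M :=
  invmx (E z al2) *m (1%:M - p).

Definition moved_transversal E al1 al2 p z : Prop :=
  ((moved1 E al1 p z)^T :&: (moved2 E al2 p z)^T)%MS = 0.

(* the projection onto the first moved space along the second one *)
Definition moved_proj E al1 al2 p z : M :=
  (proj_mx (moved1 E al1 p z)^T (moved2 E al2 p z)^T)^T.

(* the action of the simple element (al1, al2, p) on u, where E is the
   trivialization of u; meaningful where moved_transversal holds *)
Definition dress a E al1 al2 p u : R * R -> M :=
  fun z => u z + (al1 - al2) *: lie a (moved_proj E al1 al2 p z).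

Definition phi (al1 al2 be1 be2 : C) (p1 p2 : M) : M :=
  (al2%:M + (al1 - al2) *: p1) - (be2%:M + (be1 - be2) *: p2).

End Hierarchy.

(* Main.v *)
Require Import Defs.
From HB Require Import structures.
From mathcomp Require Import all_boot all_order all_algebra.
From mathcomp Require Import complex.
From mathcomp Require Import all_classical all_reals all_analysis.
From mathcomp Require Import separable ring.
From mathcomp Require mpoly.

Set Implicit Arguments.
Unset Strict Implicit.
Unset Printing Implicit Defensive.

Import Order.TTheory GRing.Theory Num.Theory numFieldNormedType.Exports.

Local Open Scope classical_set_scope.
Local Open Scope ring_scope.

(** Let X_alpha(x, t) be alpha_2 + (alpha_1 - alpha_2) pi(x, t), where pi(x, t)
    is the moved projection of a simple element ([elt_root]). The action of the
    simple element on u lifts to trivializations: the dressed potential has a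
    trivialization E1 with
      E1(lambda) (lambda - X_alpha(x, t)) = (lambda - X_alpha(0, 0)) E(lambda)
    for all lambda ([dressing]). Granted this for both elements, the theorem is
    linear algebra. The matrix phi = X_alpha - X_beta acts on the image of pi_1
    as alpha_1 - X_beta and on its kernel as alpha_2 - X_beta, so the relation
    above, for beta and at lambda = alpha_1, alpha_2, says that the second
    trivialization moves tau_1 to the conjugate of the moved pi_1
    ([moved_conj]); and phi (X_alpha - X_beta) phi^-1 = phi is the equality of
    the two potentials ([elt_root_exchange]).

    For [dressing], differentiating the relations between E and the moved
    projection gives the derivatives of X ([pderiv_moved_proj]), and a division
    by lambda - X then yields the dressed linear system, with coefficients
    those of (1 - X / lambda) Q(u) (1 - X / lambda)^-1
    ([gauged_remainder]). The main point is that these coefficients are the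
    Q_k of the dressed potential ([gauged_Q]). They satisfy its recursion,
    which leaves in each new coefficient an ambiguity D commuting with a. As b
    is diagonalizable, a polynomial P with simple roots annihilates it. The
    coefficients of P(Q(u)) again satisfy the recursion and start with 0; term
    by term, such a sequence is constant in x along every potential, and
    Hermite interpolation joins any jet to the zero jet, so it vanishes
    ([lax_eq0]). Hence P
    annihilates Q for every potential, and also the conjugated series;
    comparing the two series to first order gives P'(b) D = 0, thus D = 0
    ([lax_unique]).

    At lambda = alpha_1, alpha_2 the matrix lambda - X is singular, and E1 is a
    limit that involves the derivative of E in lambda ([special_frame]). A
    trivialization is only smooth in (x, t) for each lambda, so this derivative
    is constructed by variation of constants, as a primitive of a closed 1-form
    on a square ([lambda_derivative], [poincare]). *)

(** * Smooth functions and their partial derivatives *)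

Section RealSmooth.
Context {R : realType} {V : normedModType R} (dirs : seq V) (A : set V).
Hypothesis oA : open A.
Implicit Types (f g : V -> R) (k : nat).

Lemma near_open (z : V) (P : V -> Prop) : A z -> (forall w, A w -> P w) ->
  \near z, P z.
Proof. by move=> Az AP; apply: filterS AP _; exact: open_nbhs_nbhs. Qed.

(** On an open set the derivatives only depend on the values on this set. *)
Lemma Ck_on_ext k f g : (forall z, A z -> f z = g z) ->
  Ck_on dirs A k f -> Ck_on dirs A k g.
Proof.
elim: k f g => [|k IH] f g fg [cf Hf]; split.
- move=> z Az; have fgz : \near z, f z = g z by apply: near_open.
  rewrite /prop_for /continuous_at -(fg _ Az).
  by apply: cvg_trans (cf _ Az); apply: near_eq_cvg.
- by [].
- move=> z Az; have fgz : \near z, f z = g z by apply: near_open.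
  rewrite /prop_for /continuous_at -(fg _ Az).
  by apply: cvg_trans (cf _ Az); apply: near_eq_cvg.
- move=> v vd; have [df Df] := Hf v vd; split.
    by move=> z Az; apply: near_eq_derivable (df z Az); apply: near_open.
  apply: IH Df => z Az; apply: near_eq_derive; exact: near_open.
Qed.

Lemma Ck_onS k f : Ck_on dirs A k.+1 f -> Ck_on dirs A k f.
Proof.
elim: k f => [|k IH] f [cf Hf]; split => //.
by move=> v vd; have [df Df] := Hf v vd; split => //; exact: IH.
Qed.

Lemma Ck_on_cst k c : Ck_on dirs A k (fun=> c).
Proof.
elim: k c => [|k IH] c; split => //; try by move=> z _; exact: cvg_cst.
move=> v _; split; first by move=> z _; exact: derivable_cst.
apply: Ck_on_ext (IH 0) => z _.
by rewrite derive_cst.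
Qed.

Lemma Ck_onD k f g : Ck_on dirs A k f -> Ck_on dirs A k g ->
  Ck_on dirs A k (fun z => f z + g z).
Proof.
elim: k f g => [|k IH] f g [cf Hf] [cg Hg]; split => //;
  try by move=> z Az; apply: cvgD; [exact: cf|exact: cg].
move=> v vd; have [df Df] := Hf v vd; have [dg Dg] := Hg v vd; split.
  by move=> z Az; apply: derivableD; [exact: df|exact: dg].
apply: Ck_on_ext (IH _ _ Df Dg) => z Az.
by rewrite -deriveD //; [exact: df|exact: dg].
Qed.

Lemma Ck_onM k f g : Ck_on dirs A k f -> Ck_on dirs A k g ->
  Ck_on dirs A k (fun z => f z * g z).
Proof.
elim: k f g => [|k IH] f g Hf Hg.
  case: Hf Hg => [cf _] [cg _]; split => //.
  by move=> z Az; apply: cvgM; [exact: cf|exact: cg].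
have [f' g'] := (Ck_onS Hf, Ck_onS Hg).
case: Hf Hg => [cf Hf] [cg Hg]; split.
  by move=> z Az; apply: cvgM; [exact: cf|exact: cg].
move=> v vd; have [df Df] := Hf v vd; have [dg Dg] := Hg v vd; split.
  by move=> z Az; apply: derivableM; [exact: df|exact: dg].
apply: Ck_on_ext (Ck_onD (IH _ _ f' Dg) (IH _ _ g' Df)) => z Az /=.
exact/esym/(deriveM (df z Az) (dg z Az)).
Qed.

Lemma Ck_onN k f : Ck_on dirs A k f -> Ck_on dirs A k (fun z => - f z).
Proof.
move=> Hf; apply: Ck_on_ext (Ck_onM (Ck_on_cst k (-1)) Hf) => z _.
by rewrite mulN1r.
Qed.

Lemma Ck_onV k f : (forall z, A z -> f z != 0) -> Ck_on dirs A k f ->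
  Ck_on dirs A k (fun z => (f z)^-1).
Proof.
move=> f0; elim: k f f0 => [|k IH] f f0 Hf.
  by case: Hf => cf _; split => // z Az; apply: cvgV; [exact: f0|exact: cf].
have f' := IH _ f0 (Ck_onS Hf); case: Hf => cf Hf; split.
  by move=> z Az; apply: cvgV; [exact: f0|exact: cf].
move=> v vd; have [df Df] := Hf v vd; split.
  by move=> z Az; apply: derivableV; [exact: f0|exact: df].
apply: Ck_on_ext (Ck_onN (Ck_onM (Ck_onM f' f') Df)) => z Az /=.
by rewrite deriveV ?f0 //; [rewrite expr2 invfM /GRing.scale /= mulNr|exact: df].
Qed.

Lemma smooth_on_ext f g : (forall z, A z -> f z = g z) ->
  smooth_on dirs A f -> smooth_on dirs A g.
Proof. by move=> fg sf k; apply: Ck_on_ext (sf k). Qed.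

Lemma smooth_on_derivable f v z : smooth_on dirs A f -> v \in dirs -> A z ->
  derivable f z v.
Proof. by move=> /(_ 1%N) [_ H] vd Az; have [+ _] := H v vd; exact. Qed.

Lemma smooth_on_derive f v : smooth_on dirs A f -> v \in dirs ->
  smooth_on dirs A ('D_v f).
Proof. by move=> sf vd k; have [_ /(_ v vd)[]] := sf k.+1. Qed.

Lemma smooth_on_continuous f z : smooth_on dirs A f -> A z ->
  {for z, continuous f}.
Proof. by move=> sf Az; have [/(_ z Az)] := sf 0%N. Qed.

Lemma smooth_onP f : (forall z, A z -> {for z, continuous f}) ->
  (forall v, v \in dirs -> (forall z, A z -> derivable f z v) /\
                           smooth_on dirs A ('D_v f)) ->
  smooth_on dirs A f.
Proof.
by move=> cf Hf [|k]; split => // v vd; have [df sf] := Hf v vd; split.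
Qed.

End RealSmooth.

Lemma Ck_on_sub {R : realType} {V : normedModType R} (dirs : seq V)
    (A B : set V) k (f : V -> R) : B `<=` A ->
  Ck_on dirs A k f -> Ck_on dirs B k f.
Proof.
move=> BA; elim: k f => [|k IH] f [cf Hf]; split => //;
  try by move=> z /BA; exact: cf.
move=> v vd; have [df Df] := Hf v vd; split; last exact: IH.
by move=> z /BA; exact: df.
Qed.

(** The real and the imaginary part of a product of complex functions both
    have this shape. *)
Lemma derive_prodB {R : realType} {V : normedModType R} (f g h k : V -> R)
    (z v : V) :
  derivable f z v -> derivable g z v -> derivable h z v -> derivable k z v ->
  'D_v (fun w => f w * g w - h w * k w) z =
    (f z * 'D_v g z + g z * 'D_v f z) - (h z * 'D_v k z + k z * 'D_v h z).
Proof.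
move=> df dg dh dk.
have dfg : derivable (fun w => f w * g w) z v := derivableM df dg.
have dhk : derivable (fun w => h w * k w) z v := derivableM dh dk.
have e1 : 'D_v (fun w => f w * g w) z = f z * 'D_v g z + g z * 'D_v f z.
  exact: (deriveM df dg).
have e2 : 'D_v (fun w => h w * k w) z = h z * 'D_v k z + k z * 'D_v h z.
  exact: (deriveM dh dk).
rewrite -e1 -e2.
exact: (deriveB dfg dhk).
Qed.

Section ComplexSmooth.
Local Open Scope complex_scope.
Context {R : realType}.
Local Notation C := (R[i]).
Implicit Types (A : set (R * R)) (f g : R * R -> C) (v z : R * R).

Definition smoothC A f :=
  smooth_on xt_dirs A (fun z => complex.Re (f z)) /\
  smooth_on xt_dirs A (fun z => complex.Im (f z)).

Definition pderivC v f z : C :=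
  'D_v (fun w => complex.Re (f w)) z +i* 'D_v (fun w => complex.Im (f w)) z.

Lemma smoothC_sub A B f : B `<=` A -> smoothC A f -> smoothC B f.
Proof. by move=> BA [f1 f2]; split => k; apply: (Ck_on_sub BA). Qed.

Lemma smoothC_cst A c : open A -> smoothC A (fun=> c).
Proof. by move=> oA; split => k; exact: Ck_on_cst. Qed.

Lemma pderivC_cst v c z : pderivC v (fun=> c) z = 0.
Proof. by rewrite /pderivC !derive_cst. Qed.

Context (A : set (R * R)) (oA : open A).

Lemma smoothC_ext f g : (forall z, A z -> f z = g z) -> smoothC A f ->
  smoothC A g.
Proof.
by move=> fg [f1 f2]; split; [move: f1|move: f2];
  apply: smooth_on_ext => // z /fg ->.
Qed.

Lemma pderivC_ext f g v z : (forall z, A z -> f z = g z) -> A z ->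
  pderivC v f z = pderivC v g z.
Proof.
by move=> fg Az; congr (_ +i* _); apply: near_eq_derive;
  apply: (near_open oA Az) => w /fg ->.
Qed.

Lemma smoothCD f g : smoothC A f -> smoothC A g ->
  smoothC A (fun z => f z + g z).
Proof.
move=> [f1 f2] [g1 g2]; split => k.
  apply: (Ck_on_ext oA _ (Ck_onD oA (f1 k) (g1 k))) => z _.
  by case: (f z) (g z) => ? ? [].
apply: (Ck_on_ext oA _ (Ck_onD oA (f2 k) (g2 k))) => z _.
by case: (f z) (g z) => ? ? [].
Qed.

Lemma smoothCM f g : smoothC A f -> smoothC A g ->
  smoothC A (fun z => f z * g z).
Proof.
move=> [f1 f2] [g1 g2]; split => k.
  apply: (Ck_on_ext oA _ (Ck_onD oA (Ck_onM oA (f1 k) (g1 k))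
     (Ck_onN oA (Ck_onM oA (f2 k) (g2 k))))) => z _.
  by case: (f z) (g z) => ? ? [].
apply: (Ck_on_ext oA _ (Ck_onD oA (Ck_onM oA (f1 k) (g2 k))
     (Ck_onM oA (f2 k) (g1 k)))) => z _.
by case: (f z) (g z) => ? ? [].
Qed.

Lemma smoothCV f : (forall z, A z -> f z != 0) -> smoothC A f ->
  smoothC A (fun z => (f z)^-1).
Proof.
move=> f0 [f1 f2].
(* N is the squared modulus: 1 / f is the conjugate of f divided by N. *)
pose N z := complex.Re (f z) * complex.Re (f z)
             + complex.Im (f z) * complex.Im (f z).
have N0 z : A z -> N z != 0.
  move=> /f0; rewrite /N; case: (f z) => x y /= xy0.
  rewrite -!expr2 paddr_eq0 ?sqr_ge0 // !expf_eq0 /=.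
  by apply: contra xy0 => /andP[/eqP -> /eqP ->].
have sN k : Ck_on xt_dirs A k (fun z => (N z)^-1).
  by apply: (Ck_onV oA N0); apply: (Ck_onD oA); apply: (Ck_onM oA).
split => k.
  apply: (Ck_on_ext oA _ (Ck_onM oA (f1 k) (sN k))) => z _.
  by rewrite /N; case: (f z).
apply: (Ck_on_ext oA _ (Ck_onN oA (Ck_onM oA (f2 k) (sN k)))) => z _.
by rewrite /N; case: (f z).
Qed.

Lemma smoothC_sum (I : Type) (r : seq I) (P : pred I) (F : I -> R * R -> C) :
  (forall i, smoothC A (F i)) ->
  smoothC A (fun z => \sum_(i <- r | P i) F i z).
Proof.
move=> sF; elim: r => [|i r IH].
  by apply: smoothC_ext (smoothC_cst 0 oA) => z _; rewrite big_nil.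
case Pi: (P i); last by apply: smoothC_ext IH => z _; rewrite big_cons Pi.
by apply: smoothC_ext (smoothCD (sF i) IH) => z _; rewrite big_cons Pi.
Qed.

Lemma smoothC_prod (I : Type) (r : seq I) (P : pred I) (F : I -> R * R -> C) :
  (forall i, smoothC A (F i)) ->
  smoothC A (fun z => \prod_(i <- r | P i) F i z).
Proof.
move=> sF; elim: r => [|i r IH].
  by apply: smoothC_ext (smoothC_cst 1 oA) => z _; rewrite big_nil.
case Pi: (P i); last by apply: smoothC_ext IH => z _; rewrite big_cons Pi.
by apply: smoothC_ext (smoothCM (sF i) IH) => z _; rewrite big_cons Pi.
Qed.

Lemma smoothC_pderivC f v : v \in xt_dirs -> smoothC A f ->
  smoothC A (pderivC v f).
Proof. by move=> vd [f1 f2]; split; apply: smooth_on_derive. Qed.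

Section AtPoint.
Context (v z : R * R) (vd : v \in xt_dirs) (Az : A z).

Lemma pderivCD f g : smoothC A f -> smoothC A g ->
  pderivC v (fun z => f z + g z) z = pderivC v f z + pderivC v g z.
Proof.
move=> [f1 f2] [g1 g2]; rewrite /pderivC.
have -> : (fun w => complex.Re (f w + g w)) =
  (fun w => complex.Re (f w)) \+ (fun w => complex.Re (g w)).
  by apply/funext => w /=; case: (f w) (g w) => ? ? [].
have -> : (fun w => complex.Im (f w + g w)) =
  (fun w => complex.Im (f w)) \+ (fun w => complex.Im (g w)).
  by apply/funext => w /=; case: (f w) (g w) => ? ? [].
by rewrite !deriveD //; exact: (smooth_on_derivable _ vd Az).
Qed.

Lemma pderivCM f g : smoothC A f -> smoothC A g ->
  pderivC v (fun z => f z * g z) z = pderivC v f z * g z + f z * pderivC v g z.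
Proof.
move=> [f1 f2] [g1 g2]; rewrite /pderivC.
have -> : (fun w => complex.Re (f w * g w)) = (fun w =>
    complex.Re (f w) * complex.Re (g w) - complex.Im (f w) * complex.Im (g w)).
  by apply/funext => w; case: (f w) (g w) => ? ? [].
have -> : (fun w => complex.Im (f w * g w)) = (fun w =>
    complex.Re (f w) * complex.Im (g w) - - complex.Im (f w) * complex.Re (g w)).
  by apply/funext => w; rewrite mulNr opprK; case: (f w) (g w) => ? ? [].
have [Dfr Dfi] := (smooth_on_derivable f1 vd Az, smooth_on_derivable f2 vd Az).
have [Dgr Dgi] := (smooth_on_derivable g1 vd Az, smooth_on_derivable g2 vd Az).
rewrite (derive_prodB Dfr Dgr Dfi Dgi).
rewrite (derive_prodB Dfr Dgi (derivableN Dfi) Dgr) deriveN //.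
move: ('D_v _ z) ('D_v _ z) ('D_v _ z) ('D_v _ z) => x1 x2 x3 x4.
rewrite -[(- (fun _ => _)) z]/(- complex.Im (f z)).
case: (f z) (g z) => [a b] [c d].
by apply/eqP; rewrite eq_complex /=; apply/andP; split; apply/eqP; ring.
Qed.

Lemma pderivC_sum (I : Type) (r : seq I) (P : pred I) (F : I -> R * R -> C) :
  (forall i, smoothC A (F i)) ->
  pderivC v (fun z => \sum_(i <- r | P i) F i z) z =
  \sum_(i <- r | P i) pderivC v (F i) z.
Proof.
move=> sF; elim: r => [|i r IH].
  rewrite big_nil (_ : (fun _ => _) = fun=> 0) ?pderivC_cst //.
  by apply/funext => w; rewrite big_nil.
rewrite big_cons; case Pi: (P i).
  rewrite -IH -(pderivCD (sF i) (smoothC_sum r P sF)).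
  by congr (pderivC v _ z); apply/funext => w; rewrite big_cons Pi.
by rewrite -IH; congr (pderivC v _ z); apply/funext => w; rewrite big_cons Pi.
Qed.

End AtPoint.
End ComplexSmooth.

Section MatrixSmooth.
Context {R : realType} {n : nat}.
Local Notation M := ('M[R[i]]_n).
Implicit Types (A : set (R * R)) (F G : R * R -> M) (v z : R * R).

Local Notation smoothM := (@smooth_mx_on R _ n xt_dirs).

Lemma pderivE v F z i k : pderiv v F z i k = pderivC v (fun w => F w i k) z.
Proof. by rewrite mxE. Qed.

Lemma smoothM_sub A B F : B `<=` A -> smoothM A F -> smoothM B F.
Proof. by move=> BA sF i k; apply: (smoothC_sub BA); exact: sF. Qed.

Lemma smoothM_cst A (X : M) : open A -> smoothM A (fun=> X).
Proof. by move=> oA i k; exact: (smoothC_cst _ oA). Qed.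

Lemma pderiv_cst v (X : M) z : pderiv v (fun=> X) z = 0.
Proof. by apply/matrixP => i k; rewrite pderivE pderivC_cst mxE. Qed.

Context (A : set (R * R)) (oA : open A).

Lemma smoothM_ext F G : (forall z, A z -> F z = G z) -> smoothM A F ->
  smoothM A G.
Proof.
by move=> FG sF i k; apply: (smoothC_ext oA _ (sF i k)) => z /FG ->.
Qed.

Lemma pderiv_ext F G v z : (forall z, A z -> F z = G z) -> A z ->
  pderiv v F z = pderiv v G z.
Proof.
move=> FG Az; apply/matrixP => i k; rewrite !pderivE.
by apply: (pderivC_ext oA _ _ Az) => w /FG ->.
Qed.

Lemma smoothMD F G : smoothM A F -> smoothM A G ->
  smoothM A (fun z => F z + G z).
Proof.
move=> sF sG i k; apply: (smoothC_ext oA _ (smoothCD oA (sF i k) (sG i k))).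
by move=> z _; rewrite mxE.
Qed.

Lemma smoothMM F G : smoothM A F -> smoothM A G ->
  smoothM A (fun z => F z *m G z).
Proof.
move=> sF sG i k.
pose H := fun l z => F z i l * G z l k.
apply: (@smoothC_ext _ _ oA (fun z => \sum_(l <- index_enum 'I_n) H l z)).
  by move=> z _; rewrite mxE.
by apply: (smoothC_sum oA) => l; exact: (smoothCM oA (sF i l) (sG l k)).
Qed.

Lemma smoothMZ (f : R * R -> R[i]) F : smoothC A f -> smoothM A F ->
  smoothM A (fun z => f z *: F z).
Proof.
move=> sf sF i k; apply: (smoothC_ext oA _ (smoothCM oA sf (sF i k))).
by move=> z _; rewrite mxE.
Qed.

Lemma smoothMZl (c : R[i]) F : smoothM A F -> smoothM A (fun z => c *: F z).
Proof. exact: (smoothMZ (smoothC_cst c oA)). Qed.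

Lemma smoothMN F : smoothM A F -> smoothM A (fun z => - F z).
Proof.
move=> sF; apply: smoothM_ext (smoothMZl (-1) sF) => z _.
by rewrite scaleN1r.
Qed.

Lemma smoothMB F G : smoothM A F -> smoothM A G ->
  smoothM A (fun z => F z - G z).
Proof. by move=> sF sG; exact: (smoothMD sF (smoothMN sG)). Qed.

Lemma smoothM_sum (I : Type) (r : seq I) (P : pred I) (F : I -> R * R -> M) :
  (forall i, smoothM A (F i)) ->
  smoothM A (fun z => \sum_(i <- r | P i) F i z).
Proof.
move=> sF i k.
apply: (@smoothC_ext _ _ oA (fun z => \sum_(l <- r | P l) F l z i k)).
  by move=> z _; rewrite summxE.
by apply: (smoothC_sum oA) => l; exact: sF.
Qed.

Lemma smoothM_lie F G : smoothM A F -> smoothM A G ->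
  smoothM A (fun z => lie (F z) (G z)).
Proof.
by move=> sF sG; exact: (smoothMB (smoothMM sF sG) (smoothMM sG sF)).
Qed.

Lemma smoothM_pderiv F v : v \in xt_dirs -> smoothM A F ->
  smoothM A (pderiv v F).
Proof.
move=> vd sF i k; apply: (smoothC_ext oA _ (smoothC_pderivC vd (sF i k))).
by move=> z _; rewrite pderivE.
Qed.

Section AtPoint.
Context (v z : R * R) (vd : v \in xt_dirs) (Az : A z).

Lemma pderivD F G : smoothM A F -> smoothM A G ->
  pderiv v (fun z => F z + G z) z = pderiv v F z + pderiv v G z.
Proof.
move=> sF sG; apply/matrixP => i k; rewrite !(pderivE, mxE).
transitivity (pderivC v (fun w => F w i k + G w i k) z).
  by congr (pderivC v _ z); apply/funext => w; rewrite mxE.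
exact: (pderivCD vd Az (sF i k) (sG i k)).
Qed.

Lemma pderivM F G : smoothM A F -> smoothM A G ->
  pderiv v (fun z => F z *m G z) z = pderiv v F z *m G z + F z *m pderiv v G z.
Proof.
move=> sF sG; apply/matrixP => i k; rewrite pderivE !mxE -big_split /=.
transitivity (pderivC v (fun w => \sum_l F w i l * G w l k) z).
  by congr (pderivC v _ z); apply/funext => w; rewrite mxE.
rewrite (pderivC_sum oA vd Az) => [|l]; last by apply: smoothCM.
by apply: eq_bigr => l _; rewrite (pderivCM vd Az) // !pderivE.
Qed.

Lemma pderivZ (c : R[i]) F : smoothM A F ->
  pderiv v (fun z => c *: F z) z = c *: pderiv v F z.
Proof.
move=> sF; apply/matrixP => i k; rewrite pderivE mxE pderivE.
transitivity (pderivC v (fun w => c * F w i k) z).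
  by congr (pderivC v _ z); apply/funext => w; rewrite mxE.
rewrite (pderivCM vd Az (smoothC_cst _ oA) (sF i k)).
by rewrite pderivC_cst mul0r add0r.
Qed.

Lemma pderivN F : smoothM A F -> pderiv v (fun z => - F z) z = - pderiv v F z.
Proof.
move=> sF; transitivity (pderiv v (fun w => (-1) *: F w) z).
  by congr (pderiv v _ z); apply/funext => w; rewrite scaleN1r.
by rewrite (pderivZ (-1) sF) scaleN1r.
Qed.

Lemma pderivB F G : smoothM A F -> smoothM A G ->
  pderiv v (fun z => F z - G z) z = pderiv v F z - pderiv v G z.
Proof. by move=> sF sG; rewrite pderivD ?pderivN //; exact: smoothMN. Qed.

Lemma pderiv_sum (I : Type) (r : seq I) (P : pred I) (F : I -> R * R -> M) :
  (forall i, smoothM A (F i)) ->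
  pderiv v (fun z => \sum_(i <- r | P i) F i z) z =
  \sum_(i <- r | P i) pderiv v (F i) z.
Proof.
move=> sF; apply/matrixP => i k; rewrite pderivE summxE.
transitivity (pderivC v (fun w => \sum_(l <- r | P l) F l w i k) z).
  by congr (pderivC v _ z); apply/funext => w; rewrite summxE.
rewrite (pderivC_sum oA vd Az) => [|l]; last exact: sF.
by apply: eq_bigr => l _; rewrite pderivE.
Qed.

End AtPoint.

Lemma smoothM_det F : smoothM A F -> smoothC A (fun z => \det (F z)).
Proof.
move=> sF; rewrite /determinant; apply: (smoothC_sum oA) => s.
apply: (smoothCM oA); first exact: smoothC_cst.
by apply: (smoothC_prod oA) => i; exact: sF.
Qed.

End MatrixSmooth.

Section InverseSmooth.
Context {R : realType} {n : nat} (A : set (R * R)) (oA : open A).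
Local Notation M := ('M[R[i]]_n.+1).
Implicit Types (F : R * R -> M).
Local Notation smoothM := (@smooth_mx_on R _ n.+1 xt_dirs).

Lemma smoothM_invmx F : (forall z, A z -> F z \in unitmx) -> smoothM A F ->
  smoothM A (fun z => invmx (F z)).
Proof.
move=> uF sF.
apply: (@smoothM_ext _ _ _ oA (fun z => (\det (F z))^-1 *: \adj (F z))).
  by move=> z /uF Fz; rewrite /invmx Fz.
apply: (smoothMZ oA).
  apply: (smoothCV oA) (smoothM_det oA sF) => z /uF.
  by rewrite unitmxE unitfE.
move=> i k; apply: (@smoothC_ext _ _ oA (fun z => cofactor (F z) k i)).
  by move=> z _; rewrite mxE.
apply: (smoothCM oA); first exact: smoothC_cst.
apply: (smoothM_det oA) => p q.
apply: (@smoothC_ext _ _ oA (fun z => F z (lift k p) (lift i q))); last exact: sF.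
by move=> z _; rewrite !mxE.
Qed.

Lemma pderiv_invmx F v z : v \in xt_dirs -> (forall z, A z -> F z \in unitmx) ->
  smoothM A F -> A z ->
  pderiv v (fun z => invmx (F z)) z =
    - (invmx (F z) *m pderiv v F z *m invmx (F z)).
Proof.
move=> vd uF sF Az; have sV := smoothM_invmx uF sF.
have := pderiv_cst v (1%:M : M) z.
rewrite (@pderiv_ext _ _ _ oA _ (fun z => F z *m invmx (F z))) => [|w Aw|//]; last first.
  by rewrite mulmxV ?uF.
rewrite (pderivM oA vd Az sF sV) addrC => /(canRL (addrK _)).
rewrite sub0r => /(congr1 (mulmx (invmx (F z)))).
by rewrite mulKmx ?uF // mulmxN mulmxA.
Qed.

(** The squared modulus of the determinant is a continuous real function. *)
Lemma near_unitmx F z : smoothM A F -> A z -> F z \in unitmx ->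
  \near z, F z \in unitmx.
Proof.
move=> sF Az uz; have [s1 s2] := smoothM_det oA sF.
pose N w := complex.Re (\det (F w)) * complex.Re (\det (F w))
             + complex.Im (\det (F w)) * complex.Im (\det (F w)).
have NE w : (N w != 0) = (F w \in unitmx).
  rewrite unitmxE unitfE /N; case: (\det _) => x y /=.
  by rewrite -!expr2 paddr_eq0 ?sqr_ge0 // !expf_eq0 /= eq_complex.
have cN : {for z, continuous N}.
  have c1 := smooth_on_continuous s1 Az; have c2 := smooth_on_continuous s2 Az.
  by apply: cvgD; apply: cvgM.
have : \forall w \near z, N w != 0.
  by apply: (cvgr_neq0 _ cN); rewrite NE.
by apply: filterS => w; rewrite NE.
Qed.

End InverseSmooth.

(** * Primitives of closed 1-forms on a square *)

Section Slices.
Context {R : realType}.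
Implicit Types (f : R * R -> R) (x t : R).

(** The partial derivatives on the plane are derivatives of slices, so that the
    one-variable theory of integrals applies to them. *)
Lemma growth_x f x t : (fun h : R => h^-1 *: ((f \o shift (x, t)) (h *: dir_x) - f (x, t)))
  = (fun h => h^-1 *: (((fun s => f (s, t)) \o shift x) (h *: 1) - f (x, t))).
Proof.
apply/funext => h /=; congr (_ *: (f _ - _)).
by congr pair; rewrite /= /GRing.scale /= mulr0 add0r.
Qed.

Lemma growth_t f x t : (fun h : R => h^-1 *: ((f \o shift (x, t)) (h *: dir_t) - f (x, t)))
  = (fun h => h^-1 *: (((fun s => f (x, s)) \o shift t) (h *: 1) - f (x, t))).
Proof.
apply/funext => h /=; congr (_ *: (f _ - _)).
by congr pair; rewrite /= /GRing.scale /= mulr0 add0r.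
Qed.

Lemma derivable_x f x t : derivable f (x, t) dir_x = derivable (fun s => f (s, t)) x 1.
Proof. by rewrite /derivable growth_x. Qed.

Lemma derivable_t f x t : derivable f (x, t) dir_t = derivable (fun s => f (x, s)) t 1.
Proof. by rewrite /derivable growth_t. Qed.

Lemma derive_x f x t : 'D_dir_x f (x, t) = 'D_1 (fun s => f (s, t)) x.
Proof. by rewrite /derive growth_x. Qed.

Lemma derive_t f x t : 'D_dir_t f (x, t) = 'D_1 (fun s => f (x, s)) t.
Proof. by rewrite /derive growth_t. Qed.

Lemma continuous_slice_x f x t : {for (x, t), continuous f} ->
  {for x, continuous (fun s => f (s, t))}.
Proof.
move=> cf; apply: (@continuous_comp _ _ _ (fun s => (s, t)) f) => //.
exact: (cvg_pair cvg_id (cvg_cst t)).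
Qed.

Lemma continuous_slice_t f x t : {for (x, t), continuous f} ->
  {for t, continuous (fun s => f (x, s))}.
Proof.
move=> cf; apply: (@continuous_comp _ _ _ (fun s => (x, s)) f) => //.
exact: (cvg_pair (cvg_cst x) cvg_id).
Qed.

Lemma ball0E (r : R) (z : R * R) : ball ((0, 0) : R * R) r z <->
  `|z.1| < r /\ `|z.2| < r.
Proof.
by rewrite /ball /= /prod_ball /= -!ball_normE /= !sub0r !normrN.
Qed.

Lemma bounded_square f (r : R) :
  (forall x t, `|x| <= r -> `|t| <= r -> {for (x, t), continuous f}) ->
  exists K, forall x t, `|x| <= r -> `|t| <= r -> `|f (x, t)| <= K.
Proof.
move=> cf; pose A : set (R * R) := `[- r, r] `*` `[- r, r].
have cA : compact A by apply: compact_setX; exact: segment_compact.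
have AE x t : `|x| <= r -> `|t| <= r -> A (x, t).
  by move=> xr tr; split; rewrite /= in_itv /= -ler_norml.
have /compact_bounded [K [_ /(_ (K + 1))]] : compact (f @` A).
  apply: continuous_compact cA; apply: continuous_in_subspaceT => z.
  rewrite inE => -[/=]; rewrite !in_itv /= -!ler_norml => z1 z2.
  by move: (cf _ _ z1 z2); rewrite -surjective_pairing.
rewrite ltrDl ltr01 => /(_ isT) H; exists (K + 1) => x t xr tr.
by apply: H; exists (x, t) => //; exact: AE.
Qed.

End Slices.

Section Poincare.
Context {R : realType} (r rho : R).
Hypotheses (rho0 : 0 < rho) (rhor : rho < r).
Context (F1 F2 : R * R -> R).
Let B : set (R * R) := ball ((0, 0) : R * R) r.
Hypotheses (s1 : smooth_on xt_dirs B F1) (s2 : smooth_on xt_dirs B F2).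
Hypothesis closed_form : forall z, B z -> 'D_dir_t F1 z = 'D_dir_x F2 z.
Notation mu := (@lebesgue_measure R).

Let oB : open B. Proof. exact: ball_open. Qed.

Let BE x t : `|x| <= rho -> `|t| <= rho -> B (x, t).
Proof. by move=> xr tr; apply/ball0E; split; apply: le_lt_trans rhor. Qed.

Let in_norm (x y : R) : x \in `[- rho, y] -> y <= rho -> `|x| <= rho.
Proof.
rewrite in_itv /= => /andP[x1 x2] yr; rewrite ler_norml x1 /=.
exact: le_trans yr.
Qed.

(** The path of integration starts at the corner (- rho, - rho) of the square,
    so that both integrals run over increasing intervals. *)
Definition primitive0 (z : R * R) : R :=
  \int[mu]_(s in `[- rho, z.1]) F1 (s, z.2) +
  \int[mu]_(s in `[- rho, z.2]) F2 (- rho, s).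

Let norm_rho : `|- rho| <= rho. Proof. by rewrite normrN gtr0_norm. Qed.

Let cont f (x t : R) : smooth_on xt_dirs B f -> `|x| <= rho -> `|t| <= rho ->
  {for (x, t), continuous f}.
Proof. by move=> sf xr tr; apply: (smooth_on_continuous sf); exact: BE. Qed.

Let integrable_x f (y t : R) : smooth_on xt_dirs B f -> y <= rho ->
  `|t| <= rho -> mu.-integrable `[- rho, y] (EFin \o (fun s => f (s, t))).
Proof.
move=> sf yr tr; apply: continuous_compact_integrable.
  exact: segment_compact.
apply: continuous_in_subspaceT => x; rewrite inE /= => xy.
apply: continuous_slice_x; apply: (cont sf) => //; exact: in_norm xy yr.
Qed.

Let integrable_t f (y x : R) : smooth_on xt_dirs B f -> y <= rho ->
  `|x| <= rho -> mu.-integrable `[- rho, y] (EFin \o (fun s => f (x, s))).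
Proof.
move=> sf yr tr; apply: continuous_compact_integrable.
  exact: segment_compact.
apply: continuous_in_subspaceT => t; rewrite inE /= => xy.
apply: continuous_slice_t; apply: (cont sf) => //; exact: in_norm xy yr.
Qed.

Lemma primitive0_x x t : `|x| < rho -> `|t| < rho ->
  derivable primitive0 (x, t) dir_x /\ 'D_dir_x primitive0 (x, t) = F1 (x, t).
Proof.
move=> xr tr; have [x1 x2] : - rho < x /\ x < rho by move: xr; rewrite ltr_norml => /andP[].
have [d e] := continuous_FTC1_closed x2 (integrable_x s1 (lexx _) (ltW tr)) x1
  (continuous_slice_x (cont s1 (ltW xr) (ltW tr))).
rewrite derivable_x derive_x /primitive0 /=; split.
  exact: (derivableD d (derivable_cst _ _ _)).
have -> := deriveD d (derivable_cst (\int[mu]_(s in `[- rho, t]) F2 (- rho, s)) x 1).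
by rewrite derive_cst addr0 -derive1E.
Qed.

(** Differentiation under the integral sign and the closedness of the form turn
    the first integral into that of D_x F2; its boundary term at x = - rho
    cancels the derivative of the second integral. *)
Lemma primitive0_t x t : `|x| < rho -> `|t| < rho ->
  derivable primitive0 (x, t) dir_t /\ 'D_dir_t primitive0 (x, t) = F2 (x, t).
Proof.
move=> xr tr; have [x1 x2] : - rho < x /\ x < rho by move: xr; rewrite ltr_norml => /andP[].
have [t1 t2] : - rho < t /\ t < rho by move: tr; rewrite ltr_norml => /andP[].
have [d e] := continuous_FTC1_closed t2 (integrable_t s2 (lexx _) norm_rho) t1
  (continuous_slice_t (cont s2 norm_rho (ltW tr))).
have dt : dir_t \in (xt_dirs : seq (R * R)) by rewrite !inE eqxx orbT.
have dx : dir_x \in (xt_dirs : seq (R * R)) by rewrite !inE eqxx.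
have s1t := smooth_on_derive s1 dt; have s2x := smooth_on_derive s2 dx.
have [K HK] : exists K, forall x t, `|x| <= rho -> `|t| <= rho ->
   `|'D_dir_t F1 (x, t)| <= K.
  by apply: (@bounded_square _ ('D_dir_t F1)) => y s yr sr; exact: (cont s1t).
have K0 : 0 <= K by apply: le_trans (HK x t (ltW xr) (ltW tr)).
pose f (s y : R) := F1 (y, s).
have It : t \in `]- rho, rho[ by rewrite in_itv /= t1 t2.
have In (s : R) : s \in `]- rho, rho[ -> `|s| <= rho.
  by rewrite in_itv /= -ltr_norml => /ltW.
have dfE (s y : R) : partial1of2 f s y = 'D_dir_t F1 (y, s).
  by rewrite partial1of2E derive_t.
have mB : measurable (`[- rho, x] : set R) by [].
have H1 (s : R) : s \in `]- rho, rho[ -> mu.-integrable `[- rho, x] (EFin \o f s).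
  by move=> /In sr; exact: (integrable_x s1 (ltW x2) sr).
have H2 (s y : R) : s \in `]- rho, rho[ -> y \in `[- rho, x] -> derivable (f^~ y) s 1.
  move=> /In sr yx; rewrite /f -derivable_t.
  apply: (smooth_on_derivable s1 dt); apply: BE sr.
  exact: in_norm yx (ltW x2).
have H3 : mu.-integrable `[- rho, x] (EFin \o (fun=> K)).
  apply: continuous_compact_integrable; first exact: segment_compact.
  by apply: continuous_subspaceT => ?; exact: cvg_cst.
have H4 (s y : R) : s \in `]- rho, rho[ -> y \in `[- rho, x] ->
    `|partial1of2 f s y| <= K.
  by move=> /In sr yx; rewrite dfE; apply: HK sr; exact: in_norm yx (ltW x2).
have du := @derivable_under_integral R _ _ mu f _ mB t _ _ It H1 H2 (fun=> K) (fun=> K0) H3 H4.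
have De := @differentiation_under_integral R _ _ mu f _ mB t _ _ It H1 H2 (fun=> K) (fun=> K0) H3 H4.
rewrite derivable_t derive_t /primitive0 /=; split.
  exact: (derivableD du d).
have -> := deriveD du d.
rewrite -!derive1E De e.
have -> : \int[mu]_(y in `[- rho, x]) (partial1of2 f)^~ y t =
  F2 (x, t) - F2 (- rho, t).
  rewrite /Rintegral.
  under eq_integral => y /[!inE] yx.
    rewrite dfE closed_form; last by apply: BE (ltW tr); exact: in_norm yx (ltW x2).
    over.
  have FTC := @continuous_FTC2 R (fun y => 'D_dir_x F2 (y, t))
    (fun y => F2 (y, t)) _ _ x1.
  rewrite FTC; first by [].
  - apply: continuous_in_subspaceT => y; rewrite inE /= => yx.
    apply: (@continuous_slice_x _ ('D_dir_x F2)).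
    apply: (cont s2x) (ltW tr).
    exact: in_norm yx (ltW x2).
  - split.
    + move=> y yx; rewrite -derivable_x.
      apply: (smooth_on_derivable s2 dx); apply: BE (ltW tr).
      apply: (@in_norm _ x) (ltW x2); exact: subset_itv_oo_cc.
    + apply: cvg_at_right_filter.
      exact: (continuous_slice_x (cont s2 norm_rho (ltW tr))).
    + apply: cvg_at_left_filter.
      exact: (continuous_slice_x (cont s2 (ltW xr) (ltW tr))).
  - by move=> y _; rewrite derive1E -derive_x.
by rewrite subrK.
Qed.

Let B' : set (R * R) := ball ((0, 0) : R * R) rho.

Let oB' : open B'. Proof. exact: ball_open. Qed.

(** Partial derivatives that are bounded on the square make the primitive
    Lipschitz, by the mean value theorem in each variable. *)
Lemma primitive0_continuous z : B' z -> {for z, continuous primitive0}.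
Proof.
have [K1 HK1] : exists K, forall x t, `|x| <= rho -> `|t| <= rho ->
   `|F1 (x, t)| <= K by apply: bounded_square => y s; exact: (cont s1).
have [K2 HK2] : exists K, forall x t, `|x| <= rho -> `|t| <= rho ->
   `|F2 (x, t)| <= K by apply: bounded_square => y s; exact: (cont s2).
have lip1 x x' t : `|x| < rho -> `|x'| < rho -> `|t| < rho ->
    `|primitive0 (x', t) - primitive0 (x, t)| <= K1 * `|x' - x|.
  wlog xx' : x x' / x <= x'.
    move=> W xr xr' tr; have [|/ltW] := leP x x'; first by move=> ?; apply: W.
    by move=> ?; rewrite distrC [X in _ * X]distrC; apply: W.
  move=> xr xr' tr.
  have bd y : y \in `[x, x'] -> `|y| < rho.
    rewrite in_itv /= => /andP[xy yx']; move: xr xr'; rewrite !ltr_norml.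
    move=> /andP[a _] /andP[_ b].
    by rewrite (lt_le_trans a xy) (le_lt_trans yx' b).
  have [|||c cx ->] := @MVT_segment R (fun y => primitive0 (y, t)) (fun y => F1 (y, t)) x x'.
  - by [].
  - move=> y yx; have /bd yr : y \in `[x, x'] by exact: subset_itv_oo_cc.
    have [dy ey] := primitive0_x yr tr.
    by apply: DeriveDef; rewrite -?derivable_x -?derive_x.
  - apply: continuous_in_subspaceT => y; rewrite inE /= => yx.
    have [dy _] := primitive0_x (bd _ yx) tr.
    apply: differentiable_continuous; apply/derivable1_diffP.
    by rewrite -derivable_x.
  rewrite normrM ler_wpM2r //; apply: HK1; last exact: ltW.
  exact/ltW/bd.
have lip2 x t t' : `|x| < rho -> `|t| < rho -> `|t'| < rho ->
    `|primitive0 (x, t') - primitive0 (x, t)| <= K2 * `|t' - t|.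
  wlog tt' : t t' / t <= t'.
    move=> W xr tr tr'; have [|/ltW] := leP t t'; first by move=> ?; apply: W.
    by move=> ?; rewrite distrC [X in _ * X]distrC; apply: W.
  move=> xr tr tr'.
  have bd y : y \in `[t, t'] -> `|y| < rho.
    rewrite in_itv /= => /andP[ty yt']; move: tr tr'; rewrite !ltr_norml.
    move=> /andP[a _] /andP[_ b].
    by rewrite (lt_le_trans a ty) (le_lt_trans yt' b).
  have [|||c cx ->] := @MVT_segment R (fun y => primitive0 (x, y)) (fun y => F2 (x, y)) t t'.
  - by [].
  - move=> y yx; have /bd yr : y \in `[t, t'] by exact: subset_itv_oo_cc.
    have [dy ey] := primitive0_t xr yr.
    by apply: DeriveDef; rewrite -?derivable_t -?derive_t.
  - apply: continuous_in_subspaceT => y; rewrite inE /= => yx.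
    have [dy _] := primitive0_t xr (bd _ yx).
    apply: differentiable_continuous; apply/derivable1_diffP.
    by rewrite -derivable_t.
  rewrite normrM ler_wpM2r //; apply: HK2; first exact: ltW.
  exact/ltW/bd.
case: z => x t Bz; have [/= xr tr] := (ball0E _ _).1 Bz.
pose bnd (w : R * R) := K1 * `|w.1 - x| + K2 * `|w.2 - t|.
have key w : B' w -> `|primitive0 w - primitive0 (x, t)| <= bnd w.
  case: w => y s /ball0E /= [yr sr].
  rewrite (_ : _ - _ = (primitive0 (y, s) - primitive0 (x, s)) +
    (primitive0 (x, s) - primitive0 (x, t))); last by rewrite addrA subrK.
  by apply: le_trans (ler_normD _ _) _; apply: lerD; [exact: lip1|exact: lip2].
have cbnd : bnd w @[w --> (x, t)] --> 0.
  rewrite (_ : 0 = bnd (x, t)); last by rewrite /bnd /= !subrr normr0 !mulr0 addr0.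
  apply: cvgD; apply: cvgM; try exact: cvg_cst; apply: cvg_norm;
    apply: cvgB; try exact: cvg_cst; [exact: cvg_fst|exact: cvg_snd].
apply/cvgrPdist_le => e e0; near=> w.
have Bw : B' w by near: w; exact: (open_nbhs_nbhs (conj oB' Bz)).
rewrite distrC; apply: le_trans (key _ Bw) _; apply: le_trans (ler_norm _) _.
by near: w; move: cbnd => /cvgr0_norm_le; exact.
Unshelve. all: end_near. Qed.

Lemma poincare : exists G : R * R -> R,
  [/\ smooth_on xt_dirs B' G, G (0, 0) = 0,
     forall z, B' z -> 'D_dir_x G z = F1 z &
     forall z, B' z -> 'D_dir_t G z = F2 z].
Proof.
have B'B : B' `<=` B by move=> z /ball0E[a b]; apply/ball0E; split; apply: lt_trans rhor.
have sm : smooth_on xt_dirs B' primitive0.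
  apply: smooth_onP; first exact: primitive0_continuous.
  move=> v; rewrite !inE => /orP[]/eqP ->; split.
  - by move=> [x t] /ball0E[xr tr]; have [] := primitive0_x xr tr.
  - apply: (@smooth_on_ext _ _ _ _ oB' F1) => [[x t] /ball0E[xr tr]|k].
      by have [_ ->] := primitive0_x xr tr.
    exact: Ck_on_sub B'B _.
  - by move=> [x t] /ball0E[xr tr]; have [] := primitive0_t xr tr.
  - apply: (@smooth_on_ext _ _ _ _ oB' F2) => [[x t] /ball0E[xr tr]|k].
      by have [_ ->] := primitive0_t xr tr.
    exact: Ck_on_sub B'B _.
pose c := primitive0 (0, 0).
have dE v z : v \in (xt_dirs : seq (R * R)) -> B' z ->
    'D_v (fun w => primitive0 w - c) z = 'D_v primitive0 z.
  move=> vd Bz; have dp := smooth_on_derivable sm vd Bz.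
  have := deriveB dp (derivable_cst c z v).
  by rewrite derive_cst subr0.
exists (fun z => primitive0 z - c); split.
- by move=> k; apply: Ck_onD => //; exact: Ck_on_cst.
- by rewrite subrr.
- move=> [x t] Bz; have [xr tr] := (ball0E _ _).1 Bz.
  by rewrite dE ?inE ?eqxx //; have [_ ->] := primitive0_x xr tr.
- move=> [x t] Bz; have [xr tr] := (ball0E _ _).1 Bz.
  by rewrite dE ?inE ?eqxx ?orbT //; have [_ ->] := primitive0_t xr tr.
Qed.

End Poincare.

Section PoincareMatrix.
Local Open Scope complex_scope.

Lemma poincare_mx {R : realType} {n : nat} (r rho : R) (F1 F2 : R * R -> 'M[R[i]]_n) :
  0 < rho -> rho < r ->
  let B := ball ((0, 0) : R * R) r in let B' := ball ((0, 0) : R * R) rho in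
  smooth_mx_on xt_dirs B F1 -> smooth_mx_on xt_dirs B F2 ->
  (forall z, B z -> pderiv dir_t F1 z = pderiv dir_x F2 z) ->
  exists G : R * R -> 'M[R[i]]_n, [/\ smooth_mx_on xt_dirs B' G,
    G (0, 0) = 0, forall z, B' z -> pderiv dir_x G z = F1 z &
    forall z, B' z -> pderiv dir_t G z = F2 z].
Proof.
move=> rho0 rhor B B' s1 s2 e12.
have entry (ik : 'I_n * 'I_n) : exists G : (R * R -> R) * (R * R -> R),
  [/\ smooth_on xt_dirs B' G.1, smooth_on xt_dirs B' G.2,
    (G.1 (0, 0) = 0) * (G.2 (0, 0) = 0),
    forall z, B' z -> 'D_dir_x G.1 z +i* 'D_dir_x G.2 z = F1 z ik.1 ik.2 &
    forall z, B' z -> 'D_dir_t G.1 z +i* 'D_dir_t G.2 z = F2 z ik.1 ik.2].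
  case: ik => i k.
  have [a1 a2] := s1 i k; have [b1 b2] := s2 i k.
  have e z : B z -> pderivC dir_t (fun w => F1 w i k) z = pderivC dir_x (fun w => F2 w i k) z.
    by move=> Bz; rewrite -!pderivE e12.
  have [G1 [c1 c2 c3 c4]] := poincare rho0 rhor a1 b1 (fun z Bz => congr1 (@complex.Re R) (e z Bz)).
  have [G2 [d1 d2 d3 d4]] := poincare rho0 rhor a2 b2 (fun z Bz => congr1 (@complex.Im R) (e z Bz)).
  exists (G1, G2); split => //= z Bz; first by rewrite c3 // d3 //; case: (F1 z i k).
  by rewrite c4 // d4 //; case: (F2 z i k).
have /choice[G HG] := entry.
pose H z : 'M[R[i]]_n := \matrix_(i, k) ((G (i, k)).1 z +i* (G (i, k)).2 z).
have HR i k : (fun z => complex.Re (H z i k)) = (G (i, k)).1.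
  by apply/funext => z; rewrite mxE.
have HI i k : (fun z => complex.Im (H z i k)) = (G (i, k)).2.
  by apply/funext => z; rewrite mxE.
exists H; split.
- by move=> i k; rewrite HR HI; have [] := HG (i, k).
- by apply/matrixP => i k; rewrite !mxE; have [_ _ [-> ->]] := HG (i, k).
- move=> z Bz; apply/matrixP => i k; rewrite pderivE /pderivC HR HI.
  by have [_ _ _ /(_ z Bz)] := HG (i, k).
- move=> z Bz; apply/matrixP => i k; rewrite pderivE /pderivC HR HI.
  by have [_ _ _ _ /(_ z Bz)] := HG (i, k).
Qed.

End PoincareMatrix.

(** * Formal series in 1/lambda *)

Lemma subrACA {V : zmodType} (x y z t : V) : x - y - (z - t) = x - z - (y - t).
Proof. by rewrite !opprD !opprK addrACA. Qed.

Section Cauchy.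
Context {A : pzRingType}.
Implicit Types (s t : nat -> A) (x y : A).

(** A sequence s stands for the series with coefficient s k at lambda^-k. *)
Definition cauchy_prod s t : nat -> A :=
  fun k => \sum_(i < k.+1) s i * t (k - i)%N.

(** Multiplication by 1/lambda. *)
Definition delay s : nat -> A := fun k => if k is k'.+1 then s k' else 0.

Definition const_seq x : nat -> A := fun k => if k is 0%N then x else 0.

Lemma cauchy0 s t : cauchy_prod s t 0%N = s 0%N * t 0%N.
Proof. by rewrite /cauchy_prod big_ord1. Qed.

Lemma cauchy_delayr s t : cauchy_prod s (delay t) = delay (cauchy_prod s t).
Proof.
apply/funext => -[|k]; first by rewrite cauchy0 mulr0.
rewrite /cauchy_prod big_ord_recr /= subnn mulr0 addr0; apply: eq_bigr => i _.
by rewrite subSn // -ltnS.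
Qed.

Lemma cauchy_delayl s t : cauchy_prod (delay s) t = delay (cauchy_prod s t).
Proof.
apply/funext => -[|k]; first by rewrite cauchy0 mul0r.
by rewrite /cauchy_prod big_ord_recl /= mul0r add0r.
Qed.

Lemma cauchyBl s s' t :
  cauchy_prod (fun k => s k - s' k) t = fun k => cauchy_prod s t k - cauchy_prod s' t k.
Proof.
apply/funext => k; rewrite /cauchy_prod -sumrB; apply: eq_bigr => i _.
by rewrite mulrBl.
Qed.

Lemma cauchyBr s t t' :
  cauchy_prod s (fun k => t k - t' k) = fun k => cauchy_prod s t k - cauchy_prod s t' k.
Proof.
apply/funext => k; rewrite /cauchy_prod -sumrB; apply: eq_bigr => i _.
by rewrite mulrBr.
Qed.

Lemma cauchyZl x s t : cauchy_prod (fun k => x * s k) t = fun k => x * cauchy_prod s t k.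
Proof.
apply/funext => k; rewrite /cauchy_prod big_distrr; apply: eq_bigr => i _ /=.
by rewrite mulrA.
Qed.

Lemma cauchyZr x s t : cauchy_prod s (fun k => t k * x) = fun k => cauchy_prod s t k * x.
Proof.
apply/funext => k; rewrite /cauchy_prod big_distrl; apply: eq_bigr => i _ /=.
by rewrite mulrA.
Qed.

Lemma cauchyA1 x s t :
  cauchy_prod (fun k => s k * x) t = cauchy_prod s (fun k => x * t k).
Proof. by apply/funext => k; apply: eq_bigr => i _; rewrite mulrA. Qed.

(** For the series: s' (1 - x / lambda) = (1 - x / lambda) s. *)
Definition gauge x s' s : Prop :=
  (fun k => s' k - delay s' k * x) = (fun k => s k - x * delay s k).

Lemma delayZl s x : delay (fun k => x * s k) = (fun k => x * delay s k).
Proof. by apply/funext => -[|k] //=; rewrite mulr0. Qed.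

(** Both s' and t' are conjugates by 1 - x / lambda, and so is their product. *)
Lemma gauge_cauchy x s' s t' t : gauge x s' s -> gauge x t' t ->
  gauge x (cauchy_prod s' t') (cauchy_prod s t).
Proof.
rewrite /gauge => Hs Ht.
have -> : (fun k => cauchy_prod s' t' k - delay (cauchy_prod s' t') k * x) =
    cauchy_prod s' (fun k => t' k - delay t' k * x).
  by rewrite (cauchyBr _ _ (fun k => delay t' k * x)) cauchyZr cauchy_delayr.
have -> : (fun k => cauchy_prod s t k - x * delay (cauchy_prod s t) k) =
    cauchy_prod (fun k => s k - x * delay s k) t.
  by rewrite (cauchyBl _ (fun k => x * delay s k)) cauchyZl cauchy_delayl.
rewrite Ht -Hs (cauchyBr _ _ (fun k => x * delay t k)).
rewrite (cauchyBl _ (fun k => delay s' k * x)) cauchyA1.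
by rewrite cauchy_delayl -delayZl cauchy_delayr.
Qed.

Lemma gauge_comm x y : x * y = y * x -> gauge x (const_seq y) (const_seq y).
Proof. by move=> xy; apply/funext => -[|[|k]] /=; rewrite ?(mul0r, mulr0) ?xy. Qed.

Lemma gaugeB x s' s t' t : gauge x s' s -> gauge x t' t ->
  gauge x (fun k => s' k - t' k) (fun k => s k - t k).
Proof.
move=> Hs Ht; apply/funext => k.
have e1 := congr1 (@^~ k) Hs; have e2 := congr1 (@^~ k) Ht.
have -> : delay (fun k => s' k - t' k) k = delay s' k - delay t' k.
  by case: (k) => //=; rewrite subr0.
have -> : delay (fun k => s k - t k) k = delay s k - delay t k.
  by case: (k) => //=; rewrite subr0.
by rewrite mulrBl mulrBr subrACA e1 e2 subrACA.
Qed.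

(** The series 1 - x / lambda is invertible. *)
Lemma gauge_eq0 x s' s : gauge x s' s -> (forall k, s k = 0) ->
  forall k, s' k = 0.
Proof.
move=> Hs s0; elim=> [|k IH].
  by have := congr1 (@^~ 0%N) Hs; rewrite /= mul0r mulr0 !subr0 s0.
by have := congr1 (@^~ k.+1) Hs; rewrite /= IH !s0 mul0r mulr0 !subr0.
Qed.

Lemma gaugeP x s' s : s' 0%N = s 0%N ->
  (forall k, s' k.+1 = s k.+1 - x * s k + s' k * x) -> gauge x s' s.
Proof.
move=> e0 eS; apply/funext => -[|k] /=; first by rewrite mul0r mulr0 e0.
by rewrite eS addrK.
Qed.

(** For ds the x-derivative of s, the hypothesis is the Lax equation
    s_x + [lambda a + u, s] = 0. Solutions form a ring because all its terms
    are derivations; as s 0 commutes with a, the coefficient of lambda in the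
    equation vanishes. *)
Lemma cauchy_lax (a u : A) s ds t dt :
  s 0%N * a = a * s 0%N -> t 0%N * a = a * t 0%N ->
  (forall k, ds k + (u * s k - s k * u) = s k.+1 * a - a * s k.+1) ->
  (forall k, dt k + (u * t k - t k * u) = t k.+1 * a - a * t k.+1) ->
  forall k, (cauchy_prod ds t k + cauchy_prod s dt k) +
      (u * cauchy_prod s t k - cauchy_prod s t k * u)
    = cauchy_prod s t k.+1 * a - a * cauchy_prod s t k.+1.
Proof.
move=> s0 t0 Hs Ht k.
pose ads k := s k * a - a * s k; pose adt k := t k * a - a * t k.
have dsE : ds = fun k => ads k.+1 - (u * s k - s k * u).
  by apply/funext => i; rewrite /ads -Hs addrK.
have dtE : dt = fun k => adt k.+1 - (u * t k - t k * u).
  by apply/funext => i; rewrite /adt -Ht addrK.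
have ads0 : ads 0%N = 0 by rewrite /ads s0 subrr.
have adt0 : adt 0%N = 0 by rewrite /adt t0 subrr.
have e1 : cauchy_prod (fun k => ads k.+1) t k = cauchy_prod ads t k.+1.
  rewrite {2}/cauchy_prod big_ord_recl /= ads0 mul0r add0r.
  by apply: eq_bigr.
have e2 : cauchy_prod s (fun k => adt k.+1) k = cauchy_prod s adt k.+1.
  rewrite {2}/cauchy_prod big_ord_recr /= subnn adt0 mulr0 addr0.
  by apply: eq_bigr => i _; rewrite subSn // -ltnS.
rewrite dsE dtE (cauchyBl (fun k => ads k.+1)) (cauchyBr _ (fun k => adt k.+1)).
rewrite e1 e2 /ads /adt !(cauchyBl, cauchyBr, cauchyZl, cauchyZr, cauchyA1).
rewrite !opprB; move: (cauchy_prod s t k) (cauchy_prod s t k.+1) => p q.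
move: (cauchy_prod s (fun k => u * t k) k) (cauchy_prod s (fun k => a * t k) k.+1) => v w.
have -> : w - a * q + (v - u * p) + (q * a - w + (p * u - v)) =
    q * a - a * q + (p * u - u * p).
  by rewrite addrACA; congr (_ + _); rewrite addrC addrA subrK.
by rewrite -addrA (addrA (p * u - _)) subrK subrr addr0.
Qed.

End Cauchy.

Section Annihilator.
Context {R : realType} {n : nat}.
Local Notation C := (R[i]).
Local Notation M := ('M[R[i]]_n.+1).
Implicit Types (s : nat -> M) (b D : M) (r : seq C) (c : C).

Definition shift_seq c s : nat -> M := fun k => s k - const_seq c%:M k.

(** The product of the series s - c for c in r. *)
Fixpoint annihilate r s : nat -> M :=
  if r is c :: r' then cauchy_prod (shift_seq c s) (annihilate r' s)
  else const_seq 1.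

Definition root_poly r : {poly C} := \prod_(c <- r) ('X - c%:P).

Lemma gauge_annihilate x s' s r : gauge x s' s ->
  gauge x (annihilate r s') (annihilate r s).
Proof.
move=> Hs; elim: r => [|c r IH] /=; first by apply: gauge_comm; rewrite mulr1 mul1r.
have Hc : gauge x (const_seq c%:M) (const_seq c%:M).
  by apply: gauge_comm; rewrite -!mulmxE scalar_mxC.
exact: (gauge_cauchy (gaugeB Hs Hc) IH).
Qed.

Lemma annihilate0 r s : annihilate r s 0%N = horner_mx (s 0%N) (root_poly r).
Proof.
rewrite /root_poly; elim: r => [|c r IH] /=; first by rewrite big_nil rmorph1.
by rewrite cauchy0 big_cons rmorphM /= IH rmorphB /= horner_mx_X horner_mx_C.
Qed.

(** First order expansion of root_poly r at b: the factor of the first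
    coefficient D in which s and s' differ is the derivative, since D commutes
    with b. *)
Lemma annihilate_linear b D s s' k r :
  s 0%N = b -> (forall i, (i <= k)%N -> s i = s' i) ->
  D = s k.+1 - s' k.+1 -> D * b = b * D ->
  (forall i, (i <= k)%N -> annihilate r s i = annihilate r s' i) /\
  annihilate r s k.+1 - annihilate r s' k.+1 =
    horner_mx b (root_poly r)^`() * D.
Proof.
move=> sb ss' DE Db; elim: r => [|c r [IH1 IH2]] /=.
  by split => //; rewrite subrr /root_poly big_nil derivC rmorph0 mul0r.
have b0 r' : annihilate r' s 0%N = horner_mx b (root_poly r').
  by rewrite annihilate0 sb.
split=> [i ik|].
  rewrite /cauchy_prod; apply: eq_bigr => l _.
  have li : (l <= i)%N by rewrite -ltnS.
  rewrite IH1 ?(leq_trans (leq_subr _ _)) //.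
  by rewrite /shift_seq ss' // (leq_trans li).
rewrite /cauchy_prod big_ord_recr big_ord_recl [X in _ - X]big_ord_recr.
rewrite [X in _ - (X + _)]big_ord_recl /= subnn !subn0.
have -> : shift_seq c s 0%N = shift_seq c s' 0%N by rewrite /shift_seq ss'.
have -> : annihilate r s' 0%N = annihilate r s 0%N by rewrite IH1.
have -> : shift_seq c s' k.+1 = shift_seq c s k.+1 - D.
  by rewrite /shift_seq /= !subr0 DE subKr.
have -> : annihilate r s' k.+1 =
    annihilate r s k.+1 - horner_mx b (root_poly r)^`() * D by rewrite -IH2 subKr.
have -> : \sum_(i < k) shift_seq c s' (bump 0 i) * annihilate r s' (k.+1 - bump 0 i) =
    \sum_(i < k) shift_seq c s (bump 0 i) * annihilate r s (k.+1 - bump 0 i).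
  apply: eq_bigr => i _; rewrite /bump /= add1n.
  by rewrite -IH1 ?subSS ?leq_subr // /shift_seq ss'.
rewrite b0 /root_poly big_cons derivM derivB derivX derivC subr0 mul1r.
rewrite -/(root_poly r).
have -> : horner_mx b (root_poly r + ('X - c%:P) * (root_poly r)^`()) =
    horner_mx b (root_poly r) + (b - c%:M) * horner_mx b (root_poly r)^`().
  by rewrite rmorphD rmorphM rmorphB /= horner_mx_X horner_mx_C.
rewrite [RHS]mulrDl -[in RHS]mulrA.
have -> : shift_seq c s' 0%N = b - c%:M by rewrite /shift_seq /= -ss' ?sb.
have -> : horner_mx b (root_poly r) * D = D * horner_mx b (root_poly r).
  by have := @comm_mx_horner _ _ D b (root_poly r) Db; rewrite /comm_mx mulmxE => ->.
move: (b - c%:M) (shift_seq c s k.+1) (\sum_(i < k) _) => B S V.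
rewrite mulrBr mulrBl; move: (B * _) (B * _) (D * _) (S * _) => P W T U.
by apply/matrixP => i l; rewrite !mxE; ring.
Qed.

(** By a Bezout relation between a separable polynomial and its derivative, the
    latter is invertible at every zero of the former. *)
Lemma annihilate_cancel b D (r : seq C) : uniq r ->
  horner_mx b (root_poly r) = 0 -> horner_mx b (root_poly r)^`() * D = 0 ->
  D = 0.
Proof.
move=> ur hb hD.
have : separable_poly (root_poly r) by rewrite separable_prod_XsubC.
rewrite separable_poly.unlock => /Bezout_coprimepP[[p q]] /= /eqpP[[c1 c2] /= /andP[c10 c20]].
move=> /(congr1 (fun p => horner_mx b p * D)).
rewrite !linearZ /= rmorphD !rmorphM /= hb mulr0 add0r rmorph1 -!scalerAl.
rewrite -mulrA hD mulr0 scaler0 mul1r => /esym/eqP.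
by rewrite scaler_eq0 (negPf c20) => /eqP.
Qed.

End Annihilator.

(** * Interpolation of jets *)

Section Hermite.
Context {F : numFieldType}.
Implicit Types (p q : {poly F}) (x y : F).

Lemma derivn_Xsub_exp x N q k : (k <= N)%N ->
  ((('X - x%:P) ^+ N * q)^`(k)).[x] = if k == N then N`!%:R * q.[x] else 0.
Proof.
elim: N q k => [|N IH] q [|k] // kN.
- by rewrite expr0 mul1r derivn0 /= mul1r.
- by rewrite derivn0 !hornerE subrr expr0n /= mul0r.
rewrite derivSn derivM deriv_exp derivB derivX derivC subr0 mul1r /=.
have -> : ('X - x%:P) ^+ N *+ N.+1 * q + ('X - x%:P) ^+ N.+1 * q^`() =
    ('X - x%:P) ^+ N * (q *+ N.+1 + ('X - x%:P) * q^`()).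
  by rewrite mulrDr mulrnAl mulrnAr exprSr mulrA.
rewrite IH // eqSS; case: ifP => // _.
by rewrite !hornerE subrr mul0r addr0 hornerMn factS natrM mulrnAr -mulr_natl mulrA.
Qed.

(** The derivatives at x are adjusted one order m at a time by multiples of
    ('X - x)^m ('X - y)^N, which changes neither those of lower order at x nor
    the zero of order N at y. *)
Lemma hermite x y (c : nat -> F) N : x != y ->
  exists p, forall k, (k < N)%N -> p^`(k).[x] = c k /\ p^`(k).[y] = 0.
Proof.
move=> xy; suff : forall m, exists p, (forall k, (k < m)%N -> p^`(k).[x] = c k) /\
    forall k, (k < N)%N -> p^`(k).[y] = 0.
  by move=> /(_ N) [p [p1 p2]]; exists p => k kN; split; auto.
elim=> [|m [p [p1 p2]]].
  by exists 0; split => // k _; rewrite linear0 horner0.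
have xy0 : (x - y) ^+ N != 0 by rewrite expf_neq0 // subr_eq0.
have m0 : (m`!%:R : F) != 0 by rewrite pnatr_eq0 -lt0n fact_gt0.
pose e := (c m - p^`(m).[x]) / (m`!%:R * (x - y) ^+ N).
exists (p + e *: (('X - x%:P) ^+ m * ('X - y%:P) ^+ N)); split => k kN.
  rewrite linearD linearZ /= hornerD hornerZ derivn_Xsub_exp //.
  case: eqP => [-> |/eqP km]; last first.
    by rewrite mulr0 addr0 p1 // ltn_neqAle km -ltnS.
  by rewrite horner_exp hornerXsubC /e divfK ?mulf_neq0 // addrC subrK.
rewrite linearD linearZ /= hornerD hornerZ mulrC (mulrC (_ ^+ m)) derivn_Xsub_exp ?(ltnW kN) //.
by rewrite (ltn_eqF kN) p2 // mul0r addr0.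
Qed.

End Hermite.

Section PolynomialCurve.
Local Open Scope complex_scope.
Context {R : realType} {n : nat}.
Local Notation M := ('M[R[i]]_n.+1).
Implicit Types (p : {poly R}) (z : R * R).

Lemma derive_poly_x p z : derivable (fun w : R * R => p.[w.1]) z dir_x /\
  'D_dir_x (fun w : R * R => p.[w.1]) z = p^`().[z.1].
Proof.
case: z => x t; rewrite derivable_x derive_x /=; split.
  exact: derivable_horner.
by rewrite derivE derive1E.
Qed.

Lemma derive_poly_t p z : derivable (fun w : R * R => p.[w.1]) z dir_t /\
  'D_dir_t (fun w : R * R => p.[w.1]) z = 0.
Proof.
case: z => x t; rewrite derivable_t derive_t /=; split.
  exact: derivable_cst.
by rewrite derive_cst.
Qed.

Lemma smooth_poly p : smooth_on xt_dirs [set: R * R] (fun w => p.[w.1]).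
Proof.
have oT : open [set: R * R] by exact: openT.
move=> k; elim: k p => [|k IH] p; split => //.
- move=> z _.
  exact: (@continuous_comp _ _ _ fst (horner p) z cvg_fst (@continuous_horner _ p _)).
- move=> z _.
  exact: (@continuous_comp _ _ _ fst (horner p) z cvg_fst (@continuous_horner _ p _)).
move=> v; rewrite !inE => /orP[]/eqP ->; split.
- by move=> z _; have [] := derive_poly_x p z.
- by apply: (Ck_on_ext oT _ (IH p^`())) => z _; have [_ ->] := derive_poly_x p z.
- by move=> z _; have [] := derive_poly_t p z.
- apply: (Ck_on_ext oT _ (IH 0)) => z _; rewrite horner0.
  by have [_ ->] := derive_poly_t p z.
Qed.

Definition poly_curve (P Q : 'I_n.+1 -> 'I_n.+1 -> {poly R}) : R * R -> M :=
  fun w => \matrix_(i, k) ((P i k).[w.1] +i* (Q i k).[w.1]).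

Lemma smooth_poly_curve P Q :
  smooth_mx_on xt_dirs [set: R * R] (poly_curve P Q).
Proof.
move=> i k.
have -> : (fun z => complex.Re (poly_curve P Q z i k)) = fun z => (P i k).[z.1].
  by apply/funext => z; rewrite mxE.
have -> : (fun z => complex.Im (poly_curve P Q z i k)) = fun z => (Q i k).[z.1].
  by apply/funext => z; rewrite mxE.
by split; exact: smooth_poly.
Qed.

Lemma pderiv_poly_curve P Q : pderiv dir_x (poly_curve P Q) =
  poly_curve (fun i k => (P i k)^`()) (fun i k => (Q i k)^`()).
Proof.
apply/funext => z; apply/matrixP => i k; rewrite !mxE; congr (_ +i* _).
  rewrite -(derive_poly_x (P i k) z).2; congr ('D_dir_x _ z).
  by apply/funext => w; rewrite mxE.
rewrite -(derive_poly_x (Q i k) z).2; congr ('D_dir_x _ z).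
by apply/funext => w; rewrite mxE.
Qed.

Lemma jet_poly_curve P Q z k : jet (poly_curve P Q) z k =
  poly_curve (fun i l => (P i l)^`(k)) (fun i l => (Q i l)^`(k)) z.
Proof.
rewrite /jet; elim: k P Q => [|k IH] P Q //.
rewrite iterSr pderiv_poly_curve IH; congr (poly_curve _ _ z);
  by apply/funext => i; apply/funext => l; rewrite derivSn.
Qed.

End PolynomialCurve.

Section Jets.
Context {R : realType} {n : nat}.
Local Notation M := ('M[R[i]]_n.+1).
Implicit Types (a : M) (u : R * R -> M) (O : set (R * R)).

Lemma dir_x_in : dir_x \in (xt_dirs : seq (R * R)).
Proof. by rewrite !inE eqxx. Qed.

Lemma dir_t_in : dir_t \in (xt_dirs : seq (R * R)).
Proof. by rewrite !inE eqxx orbT. Qed.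

Lemma smooth_jet O u k : open O -> smooth_mx_on xt_dirs O u ->
  smooth_mx_on xt_dirs O (fun z => jet u z k).
Proof.
move=> oO su; elim: k => [|k IH] //.
exact: (smoothM_pderiv oO dir_x_in IH).
Qed.

Lemma lie_diagE a (Y : M) i k : is_diag_mx a ->
  lie a Y i k = (a i i - a k k) * Y i k.
Proof.
move=> /is_diag_mxP da; rewrite !mxE (bigD1 i) //= big1 => [|l li]; last first.
  by rewrite da ?mul0r // eq_sym.
rewrite (bigD1 k) //= big1 => [|l lk]; last by rewrite da ?mulr0.
by rewrite !addr0 mulrBl [Y i k * _]mulrC.
Qed.

(** The centralizer of a is spanned by the elementary matrices at the positions
    (k, i) with a_k = a_i. Testing on the off-diagonal ones and on differences
    of diagonal ones leaves a scalar matrix in these blocks, which has trace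
    zero. *)
Lemma sl_perpP a (X : M) : is_diag_mx a ->
  sl_perp a X <-> (forall i k, a i i = a k k -> X i k = 0).
Proof.
move=> da; have lie_diag := fun Y i k => lie_diagE Y i k da.
split=> [[trX HX] i k aik|HX]; last first.
  split; first by apply: big1 => i _; exact: HX.
  move=> Y _ aY; rewrite /mxtrace; apply: big1 => i _.
  rewrite mxE; apply: big1 => k _.
  have [aik|aik] := eqVneq (a i i) (a k k); first by rewrite HX ?mul0r.
  have := congr1 (fun A : M => A k i) aY; rewrite lie_diag mxE => /eqP.
  by rewrite mulf_eq0 subr_eq0 eq_sym (negPf aik) /= => /eqP ->; rewrite mulr0.
have Xoff (p q : 'I_n.+1) : p != q -> a p p = a q q -> X p q = 0.
  move=> pq apq; have := HX (delta_mx q p).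
  rewrite mxtrace_mulC => <-.
  - rewrite /mxtrace (bigD1 q) //= big1 => [|l lq]; rewrite ?addr0 mxE.
      rewrite (bigD1 p) //= big1 => [|l lp]; rewrite ?addr0 mxE ?eqxx /= ?mul1r //.
      by rewrite (negPf lp) mul0r.
    by apply: big1 => m _; rewrite mxE (negPf lq) mul0r.
  - rewrite /mxtrace; apply: big1 => l _; rewrite mxE.
    by case: eqP => // ->; rewrite eq_sym (negPf pq).
  - apply/matrixP => l m; rewrite lie_diag !mxE.
    by case: eqP => [->|]; case: eqP => [->|]; rewrite /= ?mulr0 // apq subrr mul0r.
have Xdiag (p q : 'I_n.+1) : X p p = X q q.
  have := HX (delta_mx p p - delta_mx q q).
  have tr1 (l : 'I_n.+1) : \tr (X *m delta_mx l l) = X l l.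
    rewrite mxtrace_mulC /mxtrace (bigD1 l) //= big1 => [|m ml]; rewrite ?addr0 mxE.
      rewrite (bigD1 l) //= big1 => [|m ml]; rewrite ?addr0 mxE ?eqxx /= ?mul1r //.
      by rewrite (negPf ml) mul0r.
    by apply: big1 => s _; rewrite mxE (negPf ml) mul0r.
  have tr2 (l : 'I_n.+1) : \tr (delta_mx l l : M) = 1.
    rewrite /mxtrace (bigD1 l) //= big1 => [|m ml]; rewrite ?addr0 mxE ?eqxx //.
    by rewrite (negPf ml).
  rewrite mulmxBr !raddfB /= !tr1 !tr2 subrr => /(_ erefl) H.
  apply/eqP; rewrite -subr_eq0; apply/eqP; apply: H.
  apply/matrixP => l m; rewrite lie_diag !mxE.
  have [->|lm] := eqVneq l m; first by rewrite subrr mul0r.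
  have lms s : (l == s) && (m == s) = false.
    by apply: contraNF lm => /andP[/eqP -> /eqP ->].
  by rewrite !lms subrr mulr0.
have [ik|] := eqVneq i k; last by move=> ik; exact: Xoff.
rewrite -ik; have : \tr X = X i i *+ n.+1.
  rewrite /mxtrace (eq_bigr (fun=> X i i)) => [|l _]; last exact: Xdiag.
  by rewrite sumr_const card_ord.
by rewrite trX => /esym/eqP; rewrite -mulr_natl mulf_eq0 pnatr_eq0 /= => /eqP.
Qed.

Lemma lieC (X Y : M) : lie X Y = - lie Y X.
Proof. by rewrite /lie opprB. Qed.

(** Hermite interpolation in x joins any finite jet to the zero jet. The entries
    in the blocks where a is scalar are set to 0, so that the curve takes its
    values in sl_perp a. *)
Lemma jet_interpolation a O u z N : is_diag_mx a -> open O ->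
  smooth_mx_on xt_dirs O u ->
  (forall w, O w -> sl_perp a (u w)) -> O z ->
  exists v : R * R -> M, [/\ smooth_mx_on xt_dirs [set: R * R] v,
    forall w, sl_perp a (v w),
    forall k, (k <= N)%N -> jet v z k = jet u z k &
    forall k, (k <= N)%N -> jet v (z.1 + 1, z.2) k = 0].
Proof.
move=> da oO su pu Oz.
have nz : z.1 != z.1 + 1 by rewrite eq_sym -subr_eq0 addrC addKr oner_eq0.
have jz i k l : a i i = a k k -> jet u z l i k = 0.
  move=> aik; move: z Oz {nz}; rewrite /jet; elim: l => [|l IH] z Oz.
    by have /(sl_perpP _ da) := pu _ Oz; exact.
  rewrite /= pderivE (pderivC_ext oO (g := fun=> 0)) ?pderivC_cst //.
have /choice[P HP] (ik : 'I_n.+1 * 'I_n.+1) := hermite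
  (fun k => complex.Re (jet u z k ik.1 ik.2)) N.+1 nz.
have /choice[Q HQ] (ik : 'I_n.+1 * 'I_n.+1) := hermite
  (fun k => complex.Im (jet u z k ik.1 ik.2)) N.+1 nz.
pose cut (P : 'I_n.+1 * 'I_n.+1 -> {poly R}) i k := if a i i == a k k then 0 else P (i, k).
exists (poly_curve (cut P) (cut Q)); split.
- exact: smooth_poly_curve.
- move=> w; apply/(sl_perpP _ da) => i k aik.
  by rewrite mxE /cut aik eqxx horner0.
- move=> k kN; rewrite jet_poly_curve; apply/matrixP => i l; rewrite mxE /cut.
  case: eqP => [ail|_]; first by rewrite linear0 horner0 jz.
  rewrite (HP (i, l) k kN).1 (HQ (i, l) k kN).1 /=.
  by case: (jet u z k i l).
- move=> k kN; rewrite jet_poly_curve; apply/matrixP => i l; rewrite !mxE /cut.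
  case: eqP => [ail|_]; first by rewrite linear0 horner0.
  by rewrite (HP (i, l) k kN).2 (HQ (i, l) k kN).2.
Qed.

End Jets.

(** * Rigidity of the recursion *)

Section LaxSequences.
Context {R : realType} {n : nat}.
Local Notation M := ('M[R[i]]_n.+1).
Local Notation jetfun := ((nat -> M) -> M).
Implicit Types (a b : M) (u : R * R -> M) (O : set (R * R)).
Implicit Types (S T : nat -> jetfun).

(** The properties of a Q-sequence that survive Cauchy products and suffice for
    rigidity; polynomials in the jet only enter through their finite order and
    the smoothness of their values. *)
Record lax_sequence a S : Prop := {
  lax_comm : forall J, S 0%N J * a = a * S 0%N J;
  lax_finite : forall k, exists N, forall J J' : nat -> M,
    (forall i, (i <= N)%N -> J i = J' i) -> S k J = S k J';
  lax_smooth : forall k O u, open O -> smooth_mx_on xt_dirs O u ->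
    smooth_mx_on xt_dirs O (fun z => S k (jet u z));
  lax_at0 : forall k, S k.+1 (fun=> 0) = 0;
  lax_rec : forall O u, open O -> smooth_mx_on xt_dirs O u ->
    (forall z, O z -> sl_perp a (u z)) ->
    forall k z, O z ->
      pderiv dir_x (fun w => S k (jet u w)) z + lie (u z) (S k (jet u z))
      = lie (S k.+1 (jet u z)) a }.

Lemma lax_scalar a (c : R[i]) :
  lax_sequence a (fun k (_ : nat -> M) => const_seq c%:M k).
Proof.
have cc (X : M) : c%:M *m X = X *m c%:M by rewrite scalar_mxC.
split => //.
- by move=> J; rewrite -!mulmxE /= cc.
- by move=> k; exists 0%N.
- by move=> k O u oO su; exact: smoothM_cst.
move=> O u oO su pu k z Oz; rewrite pderiv_cst add0r.
case: k => [|k] /=; first by rewrite /lie cc mul0mx mulmx0 !subrr.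
by rewrite /lie !mulmx0 !mul0mx.
Qed.

Lemma laxB a S T : lax_sequence a S -> lax_sequence a T ->
  lax_sequence a (fun k J => S k J - T k J).
Proof.
move=> lS lT; split.
- by move=> J; rewrite mulrBl mulrBr (lax_comm lS) (lax_comm lT).
- move=> k; have [N1 H1] := lax_finite lS k; have [N2 H2] := lax_finite lT k.
  exists (maxn N1 N2) => J J' JJ'; congr (_ - _).
    by apply: H1 => i iN; apply: JJ'; rewrite leq_max iN.
  by apply: H2 => i iN; apply: JJ'; rewrite leq_max iN orbT.
- move=> k O u oO su.
  exact: (smoothMB oO (lax_smooth lS k oO su) (lax_smooth lT k oO su)).
- by move=> k; rewrite (lax_at0 lS) (lax_at0 lT) subrr.
move=> O u oO su pu k z Oz.
rewrite (pderivB oO dir_x_in Oz (lax_smooth lS k oO su) (lax_smooth lT k oO su)).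
have lieBr (X Y Z : M) : lie X (Y - Z) = lie X Y - lie X Z.
  by rewrite /lie mulmxBr mulmxBl subrACA.
have lieBl (X Y Z : M) : lie (X - Y) Z = lie X Z - lie Y Z.
  by rewrite /lie mulmxBr mulmxBl subrACA.
rewrite lieBr lieBl -(lax_rec lS oO su pu k Oz) -(lax_rec lT oO su pu k Oz).
by rewrite (opprD (pderiv _ _ _)) addrACA.
Qed.

Lemma lax_cauchy a S T : lax_sequence a S -> lax_sequence a T ->
  lax_sequence a (fun k J => cauchy_prod (fun i => S i J) (fun i => T i J) k).
Proof.
move=> lS lT; split.
- move=> J; rewrite !cauchy0.
  by rewrite -mulrA (lax_comm lT) mulrA (lax_comm lS) mulrA.
- move=> k.
  have /choice[N1 H1] := lax_finite lS; have /choice[N2 H2] := lax_finite lT.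
  pose N := \max_(i < k.+1) maxn (N1 i) (N2 (k - i)%N).
  exists N => J J' JJ'; apply: eq_bigr => i _; congr (_ * _).
    apply: H1 => l lN; apply: JJ'; apply: leq_trans lN _.
    by rewrite /N (bigD1 i) //= !leq_max leqnn.
  apply: H2 => l lN; apply: JJ'; apply: leq_trans lN _.
  by rewrite /N (bigD1 i) //= !leq_max leqnn orbT.
- move=> k O u oO su; apply: (smoothM_sum oO) => i.
  exact: (smoothMM oO (lax_smooth lS i oO su) (lax_smooth lT (k - i) oO su)).
- move=> k; rewrite /cauchy_prod; apply: big1 => i _.
  case: i => -[|i] ik /=; first by rewrite subn0 (lax_at0 lT) mulr0.
  by rewrite (lax_at0 lS) mul0r.
move=> O u oO su pu k z Oz.
have sSk i := lax_smooth lS i oO su; have sTk i := lax_smooth lT i oO su.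
rewrite /cauchy_prod (pderiv_sum oO dir_x_in Oz _ _ (fun i : 'I_k.+1 => smoothMM oO (sSk i) (sTk (k - i)%N))).
rewrite (eq_bigr (fun i : 'I_k.+1 => pderiv dir_x (fun w => S i (jet u w)) z * T (k - i)%N (jet u z) +
   S i (jet u z) * pderiv dir_x (fun w => T (k - i)%N (jet u w)) z)); last first.
  by move=> i _; rewrite (pderivM oO dir_x_in Oz (sSk i) (sTk (k - i)%N)).
rewrite big_split /=.
exact: (@cauchy_lax M a (u z) (fun i => S i (jet u z))
  (fun i => pderiv dir_x (fun w => S i (jet u w)) z) (fun i => T i (jet u z))
  (fun i => pderiv dir_x (fun w => T i (jet u w)) z) (lax_comm lS _)
  (lax_comm lT _) (fun i => lax_rec lS oO su pu i Oz)
  (fun i => lax_rec lT oO su pu i Oz) k).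
Qed.

Lemma lax_annihilate a S (r : seq R[i]) : lax_sequence a S ->
  lax_sequence a (fun k J => annihilate r (fun i => S i J) k).
Proof.
move=> lS; elim: r => [|c r IH] /=.
  exact: (lax_scalar a 1).
exact: (lax_cauchy (laxB lS (lax_scalar a c)) IH).
Qed.

(** By induction the term S k.+1 commutes with a. In the recursion for its
    x-derivative the bracket with u is off-diagonal, for the blocks of a, like
    the right-hand side, while the derivative is block diagonal: it is zero.
    So S k.+1 is constant along a curve joining the jet of u to the zero
    jet. *)
Lemma lax_eq0 a S : is_diag_mx a -> lax_sequence a S ->
  (forall J, S 0%N J = 0) ->
  forall k O u, open O -> smooth_mx_on xt_dirs O u ->
  (forall z, O z -> sl_perp a (u z)) -> forall z, O z -> S k (jet u z) = 0.
Proof.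
move=> da lS S0; elim=> [|k IH] O u oO su pu z Oz; first exact: S0.
(* A: outside the blocks of a, the entries of S k.+1 vanish. *)
have A U v : open U -> smooth_mx_on xt_dirs U v ->
    (forall w, U w -> sl_perp a (v w)) -> forall w, U w ->
    forall i l, a i i != a l l -> S k.+1 (jet v w) i l = 0.
  move=> oU sv pv w Uw i l ail.
  have := lax_rec lS oU sv pv k Uw.
  rewrite (pderiv_ext oU (G := fun=> 0) dir_x _ Uw) => [|y Uy]; last first.
    exact: (IH U v).
  rewrite pderiv_cst (IH U v) // add0r.
  have -> : lie (v w) 0 = 0 by rewrite /lie mulmx0 mul0mx subrr.
  move=> /(congr1 (fun X : M => X i l)); rewrite lieC mxE [RHS]mxE lie_diagE //.
  move=> /esym/eqP; rewrite oppr_eq0 mulf_eq0 subr_eq0 (negPf ail) /=.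
  by move=> /eqP.
have D v : smooth_mx_on xt_dirs [set: R * R] v ->
    (forall w, sl_perp a (v w)) ->
    forall w, pderiv dir_x (fun w => S k.+1 (jet v w)) w = 0.
  move=> sv pv w; apply/matrixP => i l; rewrite [RHS]mxE.
  have oT : open [set: R * R] := openT.
  have pv' : forall w, [set: R * R] w -> sl_perp a (v w) by move=> ? _.
  have Aw := A _ v oT sv pv' _ I.
  have [ail|ail] := eqVneq (a i i) (a l l); last first.
    rewrite pderivE (pderivC_ext oT (g := fun=> 0)) ?pderivC_cst //.
    by move=> y _; exact: Aw.
  have := lax_rec lS oT sv pv' k.+1 (I : [set: R * R] w).
  move=> /(congr1 (fun X : M => X i l)).
  rewrite [X in _ = X -> _](_ : _ = 0); last first.
    by rewrite lieC mxE lie_diagE // ail subrr mul0r oppr0.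
  rewrite mxE (_ : lie (v w) _ i l = 0) ?addr0 //.
  have pw := (sl_perpP (v w) da).1 (pv w).
  rewrite !mxE [X in X - _]big1 => [|m _]; last first.
    have [aml|aml] := eqVneq (a m m) (a l l); first by rewrite pw ?mul0r // ail.
    by rewrite Aw ?mulr0.
  rewrite big1 ?subrr // => m _.
  have [aim|aim] := eqVneq (a i i) (a m m); first by rewrite pw ?mulr0 // -aim.
  by rewrite Aw ?mul0r.
have [N HN] := lax_finite lS k.+1.
have [v [sv pv jv jv0]] := jet_interpolation N da oO su pu Oz.
rewrite -(HN _ _ jv).
have jv0' : S k.+1 (jet v (z.1 + 1, z.2)) = 0.
  by rewrite (HN _ (fun=> 0)) ?(lax_at0 lS) // => i /jv0.
rewrite -jv0'.
have sSv := lax_smooth lS k.+1 openT sv.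
have cst (f : R * R -> R) : smooth_on xt_dirs [set: R * R] f ->
    (forall w, 'D_dir_x f w = 0) -> f z = f (z.1 + 1, z.2).
  move=> sf df; rewrite {1}(surjective_pairing z).
  apply: (@is_derive_0_is_cst _ (fun s => f (s, z.2))) => x.
  apply: DeriveDef; first by rewrite -derivable_x; exact: (smooth_on_derivable sf dir_x_in).
  by rewrite -derive_x.
apply/matrixP => i l.
have [s1 s2] := sSv i l.
have Dil w : pderivC dir_x (fun y => S k.+1 (jet v y) i l) w = 0.
  by rewrite -pderivE D // mxE.
have e1 := cst _ s1 (fun w => congr1 (@complex.Re R) (Dil w)).
have e2 := cst _ s2 (fun w => congr1 (@complex.Im R) (Dil w)).
by apply/eqP; rewrite eq_complex e1 e2 !eqxx.
Qed.

Lemma jet_polynomial_finite (f : (nat -> M) -> R[i]) : jet_polynomial f ->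
  exists N, forall J J' : nat -> M,
    (forall i, (i <= N)%N -> J i = J' i) -> f J = f J'.
Proof.
move=> [d [p [v fE]]]; exists (\max_(l < d) (v l).1.1) => J J' JJ'.
rewrite !fE; congr (mpoly.meval _ p); apply/funext => l.
by rewrite JJ' // (bigD1 l) //= leq_maxl.
Qed.

Lemma jet_polynomial_smooth (f : (nat -> M) -> R[i]) O u : jet_polynomial f ->
  open O -> smooth_mx_on xt_dirs O u -> smoothC O (fun z => f (jet u z)).
Proof.
move=> [d [p [v fE]]] oO su.
pose F l z := jet u z (v l).1.1 (v l).1.2 (v l).2.
have H : smoothC O (fun z => \sum_(m <- mpoly.msupp p)
    (mpoly.mcoeff m p * \prod_(l < d) (\prod_(e < mpoly.fun_of_multinom m l) F l z))).
  apply: (smoothC_sum oO) => m; apply: (smoothCM oO); first exact: smoothC_cst.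
  apply: (smoothC_prod oO) => l; apply: (smoothC_prod oO) => _.
  exact: (smooth_jet _ oO su).
apply: (smoothC_ext oO _ H) => z _; rewrite fE mpoly.mevalE.
apply: eq_bigr => m _; congr (_ * _); apply: eq_bigr => l _.
by rewrite prodr_const card_ord.
Qed.

Lemma horner_mx_comm a (q : {poly R[i]}) : horner_mx a q * a = a * horner_mx a q.
Proof. by have := @comm_horner_mx _ _ a a q erefl; rewrite /comm_mx mulmxE. Qed.

Lemma lax_Q a q Q : Q_sequence a (horner_mx a q) Q -> lax_sequence a Q.
Proof.
move=> hQ; split.
- by move=> J; rewrite (Q_zero hQ) horner_mx_comm.
- move=> k.
  have /choice[N HN] : forall il : 'I_n.+1 * 'I_n.+1, exists N, forall J J' : nat -> M,
     (forall i, (i <= N)%N -> J i = J' i) -> Q k J il.1 il.2 = Q k J' il.1 il.2.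
    by move=> il; exact: (jet_polynomial_finite (Q_polynomial hQ k il.1 il.2)).
  exists (\max_il N il) => J J' JJ'; apply/matrixP => i l.
  apply: (HN (i, l)) => m mN; apply: JJ'; apply: leq_trans mN _.
  by rewrite (bigD1 (i, l)) //= leq_maxl.
- move=> k O u oO su i l.
  exact: (jet_polynomial_smooth (Q_polynomial hQ k i l) oO su).
- exact: (Q_no_constant_term hQ).
- exact: (Q_recursion hQ).
Qed.

(** A diagonal matrix is annihilated by a polynomial with simple roots. *)
Lemma horner_root_diag a q : is_diag_mx a ->
  exists2 r : seq R[i], uniq r & horner_mx (horner_mx a q) (root_poly r) = 0.
Proof.
move=> /diag_mxP[d ->]; pose r := undup [seq q.[d 0 i] | i <- enum 'I_n.+1].
exists r; first exact: undup_uniq.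
rewrite !horner_mx_diag; apply/matrixP => i l; rewrite !mxE.
rewrite [_.[_]](_ : _ = 0) ?mul0rn //; apply/eqP; rewrite -[_ == 0]/(root _ _).
by rewrite root_prod_XsubC mem_undup; apply: map_f; rewrite mem_enum.
Qed.

(** The recursion determines s k.+1 up to a matrix D commuting with a, hence
    with b = q(a). By [annihilate_linear] the derivative of root_poly r at b
    kills D, and it is invertible as the roots are simple. *)
Lemma lax_unique a q Q (r : seq R[i]) O u (s : nat -> R * R -> M) :
  is_diag_mx a -> Q_sequence a (horner_mx a q) Q ->
  uniq r -> horner_mx (horner_mx a q) (root_poly r) = 0 ->
  open O -> smooth_mx_on xt_dirs O u -> (forall z, O z -> sl_perp a (u z)) ->
  (forall z, O z -> s 0%N z = horner_mx a q) ->
  (forall z, O z -> forall k, annihilate r (s^~ z) k = 0) ->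
  (forall k z, O z -> pderiv dir_x (s k) z + lie (u z) (s k z) = lie (s k.+1 z) a) ->
  forall k z, O z -> s k z = Q k (jet u z).
Proof.
move=> da hQ ur rb oO su pu s0 sr srec.
have lQ := lax_Q hQ; set b := horner_mx a q in hQ rb s0 *.
have annQ z k : O z -> annihilate r (fun i => Q i (jet u z)) k = 0.
  move=> Oz; apply: (lax_eq0 (S := fun k J => annihilate r (fun i => Q i J) k)
    da (lax_annihilate r lQ) _ k oO su pu Oz).
  by move=> J; rewrite annihilate0 (Q_zero hQ).
suff H k : forall i, (i <= k)%N -> forall z, O z -> s i z = Q i (jet u z).
  by move=> k z Oz; exact: (H k).
elim: k => [|k IH] i; first by rewrite leqn0 => /eqP -> z Oz; rewrite s0 // (Q_zero hQ).
rewrite leq_eqVlt => /orP[/eqP -> {i}|]; last by move=> ik; exact: IH.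
move=> z Oz; pose D := s k.+1 z - Q k.+1 (jet u z).
have Da : D * a = a * D.
  have e : lie (s k.+1 z) a = lie (Q k.+1 (jet u z)) a.
    rewrite -(srec k z Oz) -(Q_recursion hQ oO su pu k Oz).
    by rewrite (pderiv_ext oO dir_x (IH k (leqnn k)) Oz) IH.
  have : lie D a = 0 by rewrite /lie mulmxBr mulmxBl subrACA -!/(lie _ _) e subrr.
  by move=> /eqP; rewrite subr_eq0 => /eqP.
have Db : D * b = b * D.
  by have := @comm_mx_horner _ _ D a q Da; rewrite /comm_mx mulmxE.
have [_] := @annihilate_linear R n b D (s^~ z) (fun i => Q i (jet u z)) k r
  (s0 z Oz) (fun i ik => IH i ik z Oz) erefl Db.
rewrite sr // annQ // subrr => /esym/(annihilate_cancel ur rb)/eqP.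
by rewrite subr_eq0 => /eqP.
Qed.

End LaxSequences.

(** * Polynomials in lambda and division by lambda - X *)

Lemma subr_transpose {V : zmodType} (e1 e2 e3 e4 f5 f6 : V) :
  e1 - e2 - (f5 - f6) = e3 - e4 -> f5 - e1 = f6 - e2 + (e4 - e3).
Proof.
move=> H; have -> : f5 = f6 + (e1 - e2) - (e3 - e4).
  by rewrite -H -addrA subKr addrC subrK.
by rewrite opprB addrAC; congr (_ + _); rewrite -addrA [e1 - _ - _]addrAC subrr sub0r.
Qed.

Section LambdaPolynomials.
Context {K : comNzRingType} {n : nat}.
Local Notation M := ('M[K]_n.+1).
Implicit Types (s d : nat -> M) (l : K) (X : M).

(** The polynomial part of lambda^j s, in Horner form; dlpoly is its derivative
    in lambda. *)
Fixpoint lpoly j s l : M :=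
  if j is j'.+1 then l *: lpoly j' s l + s j else s 0%N.

Fixpoint dlpoly j s l : M :=
  if j is j'.+1 then l *: dlpoly j' s l + lpoly j' s l else 0.

Lemma lpolyE j s l : lpoly j s l = \sum_(k < j.+1) l ^+ (j - k) *: s k.
Proof.
elim: j => [|j IH] /=; first by rewrite big_ord1 subnn expr0 scale1r.
rewrite big_ord_recr /= subnn expr0 scale1r IH scaler_sumr; congr (_ + _).
by apply: eq_bigr => k _; rewrite scalerA -exprS subSn // -ltnS.
Qed.

Lemma lpolyB j s s' l :
  lpoly j (fun k => s k - s' k) l = lpoly j s l - lpoly j s' l.
Proof. by elim: j => [|j IH] //=; rewrite IH scalerBr opprD addrACA. Qed.

Lemma lpolyZ j c s l : lpoly j (fun k => c *: s k) l = c *: lpoly j s l.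
Proof. by elim: j => [|j IH] //=; rewrite IH scalerDr !scalerA mulrC. Qed.

Lemma lpoly_mulr j s l X : lpoly j (fun k => s k * X) l = lpoly j s l * X.
Proof. by elim: j => [|j IH] //=; rewrite IH mulrDl scalerAl. Qed.

Lemma lpoly_mull j s l X : lpoly j (fun k => X * s k) l = X * lpoly j s l.
Proof. by elim: j => [|j IH] //=; rewrite IH mulrDr scalerAr. Qed.

Lemma dlpolyB j s s' l :
  dlpoly j (fun k => s k - s' k) l = dlpoly j s l - dlpoly j s' l.
Proof.
elim: j => [|j IH] /=; first by rewrite subrr.
by rewrite IH lpolyB scalerBr opprD addrACA.
Qed.

Lemma dlpolyZ j c s l : dlpoly j (fun k => c *: s k) l = c *: dlpoly j s l.
Proof.
elim: j => [|j IH] /=; first by rewrite scaler0.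
by rewrite IH lpolyZ scalerDr !scalerA mulrC.
Qed.

Lemma dlpoly_mulr j s l X : dlpoly j (fun k => s k * X) l = dlpoly j s l * X.
Proof.
elim: j => [|j IH] /=; first by rewrite mul0r.
by rewrite IH lpoly_mulr mulrDl scalerAl.
Qed.

Lemma dlpoly_mull j s l X : dlpoly j (fun k => X * s k) l = X * dlpoly j s l.
Proof.
elim: j => [|j IH] /=; first by rewrite mulr0.
by rewrite IH lpoly_mull mulrDr scalerAr.
Qed.

Lemma lpoly_telescope j d l : d 0%N = 0 ->
  lpoly j (fun k => d k.+1 - l *: d k) l = d j.+1.
Proof.
move=> d0; elim: j => [|j IH] /=; first by rewrite d0 scaler0 subr0.
by rewrite IH addrC subrK.
Qed.

Lemma dlpoly_telescope j d l : d 0%N = 0 ->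
  dlpoly j (fun k => d k.+1 - l *: d k) l = lpoly j d l.
Proof. by move=> d0; elim: j => [|j IH] //=; rewrite IH lpoly_telescope. Qed.

(** The coefficients of (1 - X / lambda) s (1 - X / lambda)^-1. *)
Fixpoint gauged X s k : M :=
  if k is k'.+1 then s k - X * s k' + gauged X s k' * X else s 0%N.

Lemma gauged_diff X s k :
  gauged X s k.+1 - s k.+1 = gauged X s k * X - X * s k.
Proof. by rewrite /= addrAC [s _ - _]addrC addrK addrC. Qed.

(** The difference of the two products is a telescoping sum: only its last
    term, which does not involve lambda, remains. *)
Lemma lpoly_gauged j X s l :
  lpoly j (gauged X s) l * (l%:M - X) =
  (l%:M - X) * lpoly j s l + (X * s j - gauged X s j * X).
Proof.
pose d k := gauged X s k - s k.
have d0 : d 0%N = 0 by rewrite /d /= subrr.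
have := lpoly_telescope j l d0.
rewrite lpolyB lpolyZ (_ : (fun k => d k.+1) = fun k => gauged X s k * X - X * s k); last first.
  by apply/funext => k; exact: gauged_diff.
rewrite /d gauged_diff !lpolyB lpoly_mulr lpoly_mull => H.
have {}H : lpoly j (gauged X s) l * X - X * lpoly j s l -
  l *: (lpoly j (gauged X s) l - lpoly j s l) = gauged X s j * X - X * s j := H.
have sM (Y : M) : l%:M * Y = l *: Y by rewrite -mulmxE mul_scalar_mx.
have Ms (Y : M) : Y * l%:M = l *: Y by rewrite -mulmxE mul_mx_scalar.
rewrite mulrBr mulrBl sM Ms; apply: subr_transpose.
by rewrite -scalerBr.
Qed.

(** The derivative of [lpoly_gauged] in lambda. *)
Lemma dlpoly_gauged j X s l :
  dlpoly j (gauged X s) l * (l%:M - X) + lpoly j (gauged X s) l =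
  (l%:M - X) * dlpoly j s l + lpoly j s l.
Proof.
pose d k := gauged X s k - s k.
have d0 : d 0%N = 0 by rewrite /d /= subrr.
have := dlpoly_telescope j l d0.
rewrite dlpolyB dlpolyZ (_ : (fun k => d k.+1) = fun k => gauged X s k * X - X * s k); last first.
  by apply/funext => k; exact: gauged_diff.
rewrite /d lpolyB !dlpolyB dlpoly_mulr dlpoly_mull => H.
have {}H : dlpoly j (gauged X s) l * X - X * dlpoly j s l -
  l *: (dlpoly j (gauged X s) l - dlpoly j s l) =
  lpoly j (gauged X s) l - lpoly j s l := H.
have sM (Y : M) : l%:M * Y = l *: Y by rewrite -mulmxE mul_scalar_mx.
have Ms (Y : M) : Y * l%:M = l *: Y by rewrite -mulmxE mul_mx_scalar.
rewrite mulrBr mulrBl sM Ms.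
rewrite (subr_transpose (e3 := lpoly j (gauged X s) l) (e4 := lpoly j s l)
  (e1 := dlpoly j (gauged X s) l * X) (e2 := X * dlpoly j s l) (f6 := l *: dlpoly j s l)).
  by rewrite -!addrA addNr addr0.
by rewrite -scalerBr.
Qed.

End LambdaPolynomials.

(** * Moved projections *)

Section MovedProjection.
Context {R : realType} {n : nat}.
Local Notation C := (R[i]).
Local Notation M := ('M[R[i]]_n.+1).
Implicit Types (E : R * R -> C -> M) (p : M) (z : R * R).

(** Where it is invertible, this matrix sends the image of p onto the first moved
    space and the image of 1 - p onto the second one: it conjugates p to the
    moved projection. *)
Definition transition E al1 al2 p z : M := moved1 E al1 p z + moved2 E al2 p z.

Definition dressable E al1 al2 p z : Prop :=
  [/\ E z al1 \in unitmx, E z al2 \in unitmx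
    & transition E al1 al2 p z \in unitmx].

Context (E : R * R -> C -> M) (al1 al2 : C) (p : M) (z : R * R).
Hypotheses (pp : p * p = p) (gz : dressable E al1 al2 p z).
Let S := transition E al1 al2 p z.
Let uS : S \in unitmx. Proof. by have [] := gz. Qed.

Let Sp : S * p = moved1 E al1 p z.
Proof.
rewrite /S /transition /moved1 /moved2 !mulmxE mulrDl -!mulrA pp mulrBl mul1r pp.
by rewrite subrr mulr0 addr0.
Qed.

Let Sq : S * (1 - p) = moved2 E al2 p z.
Proof. by rewrite mulrBr mulr1 Sp /S /transition addrC addKr. Qed.

Lemma dressable_transversal : moved_transversal E al1 al2 p z.
Proof.
rewrite /moved_transversal -Sp -Sq -!mulmxE !trmx_mul.
apply/eqP/rowV0P => v; rewrite sub_capmx => /andP[/submxP[x vx] /submxP[y vy]].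
have uST : S^T \in unitmx by rewrite unitmx_tr.
have xy : x *m p^T = y *m (1 - p)^T.
  by rewrite -[LHS](mulmxK uST) -[x *m p^T *m _]mulmxA -vx vy mulmxA mulmxK.
have x0 : x *m p^T = 0.
  have -> : x *m p^T = x *m p^T *m p^T by rewrite -mulmxA -trmx_mul mulmxE pp.
  rewrite xy -mulmxA -trmx_mul mulmxE mulrBr mulr1 pp subrr.
  by rewrite trmx0 mulmx0.
by rewrite vx mulmxA x0 mul0mx.
Qed.

Lemma dressable_moved_proj : moved_proj E al1 al2 p z = S * p * invmx S.
Proof.
have tr := dressable_transversal; rewrite /moved_transversal in tr.
rewrite /moved_proj; set P := proj_mx _ _.
have e1 : (S * p)^T *m P = (S * p)^T.
  by rewrite Sp /P proj_mx_id.
have e2 : (S * (1 - p))^T *m P = 0.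
  by rewrite Sq /P proj_mx_0.
have e3 : S^T *m P = (S * p)^T.
  rewrite -[RHS]e1 -[RHS]addr0 -[in RHS]e2 -mulmxDl -linearD /= -mulrDr.
  by rewrite addrC subrK mulr1.
have e4 : P^T *m S = S * p by apply: trmx_inj; rewrite trmx_mul trmxK.
by rewrite -[LHS](mulmxK uS) e4.
Qed.

Let pt := moved_proj E al1 al2 p z.

Let ptS : pt * S = S * p.
Proof.
by rewrite /pt dressable_moved_proj -mulrA -[invmx S * S]/(invmx S *m S) mulVmx // mulr1.
Qed.

Lemma moved_proj_idem : pt * pt = pt.
Proof.
rewrite {2}/pt dressable_moved_proj mulrA mulrA ptS -(mulrA S) pp.
by rewrite -dressable_moved_proj.
Qed.

Let uE1 : E z al1 \in unitmx. Proof. by have [] := gz. Qed.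
Let uE2 : E z al2 \in unitmx. Proof. by have [] := gz. Qed.

Let E1Sp : E z al1 * (S * p) = p.
Proof. by rewrite Sp /moved1 -mulmxE mulKVmx. Qed.

Let E2Sq : E z al2 * (S * (1 - p)) = 1 - p.
Proof. by rewrite Sq /moved2 -mulmxE mulKVmx. Qed.

Lemma moved_proj_img : (1 - p) * E z al1 * pt = 0.
Proof.
rewrite /pt dressable_moved_proj mulrA -(mulrA (1 - p)) E1Sp mulrBl mul1r pp subrr.
by rewrite mul0r.
Qed.

Lemma moved_proj_ker : p * E z al2 * (1 - pt) = 0.
Proof.
have -> : 1 - pt = S * (1 - p) * invmx S.
  rewrite mulrBr mulrBl mulr1 -dressable_moved_proj; congr (_ - _).
  by rewrite -[RHS]/(S *m invmx S) mulmxV.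
by rewrite mulrA -(mulrA p) E2Sq mulrBr mulr1 pp subrr mul0r.
Qed.

Lemma moved_proj_fix (Y : M) : (1 - p) * E z al1 * Y = 0 -> pt * Y = Y.
Proof.
rewrite mulrBl mul1r mulrBl => /eqP; rewrite subr_eq0 => /eqP EY.
have -> : Y = S * p * (E z al1 * Y).
  by rewrite Sp /moved1 mulmxE -!mulrA [p * (_ * _)]mulrA -EY -!mulmxE mulKmx.
by rewrite (mulrA pt) (mulrA pt) ptS -(mulrA S) pp.
Qed.

Lemma moved_proj_kill (Y : M) : p * E z al2 * Y = 0 -> pt * Y = 0.
Proof.
rewrite -mulrA => EY.
have -> : Y = S * (1 - p) * (E z al2 * Y).
  rewrite Sq /moved2 mulmxE -!mulrA mulrBl mul1r EY subr0.
  by rewrite -!mulmxE mulKmx.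
by rewrite (mulrA pt) (mulrA pt) ptS -(mulrA S) mulrBr mulr1 pp subrr mulr0 mul0r.
Qed.

Lemma moved_proj_unique (Y : M) : (1 - p) * E z al1 * Y = 0 ->
  p * E z al2 * (1 - Y) = 0 -> pt = Y.
Proof.
move=> /moved_proj_fix e1 /moved_proj_kill; rewrite mulrBr mulr1 e1.
by move=> /eqP; rewrite subr_eq0 => /eqP.
Qed.

End MovedProjection.

Section MovedProjectionDerivative.
Context {R : realType} {n : nat}.
Local Notation C := (R[i]).
Local Notation M := ('M[R[i]]_n.+1).
Context (E : R * R -> C -> M) (al1 al2 : C) (p : M).
Hypothesis pp : p * p = p.
Context (A : set (R * R)) (oA : open A).
Hypothesis gA : forall z, A z -> dressable E al1 al2 p z.
Hypothesis sE : forall l, smooth_mx_on xt_dirs A (fun z => E z l).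
Let pt := moved_proj E al1 al2 p.

Lemma smooth_transition : (forall z, A z -> E z al1 \in unitmx /\ E z al2 \in unitmx) ->
  smooth_mx_on xt_dirs A (transition E al1 al2 p).
Proof.
move=> uE.
have s1 : smooth_mx_on xt_dirs A (moved1 E al1 p).
  apply: (smoothMM oA); last exact: (smoothM_cst _ oA).
  by apply: (smoothM_invmx oA) => // z /uE [].
have s2 : smooth_mx_on xt_dirs A (moved2 E al2 p).
  apply: (smoothMM oA); last exact: (smoothM_cst _ oA).
  by apply: (smoothM_invmx oA) => // z /uE [].
exact: (smoothMD oA s1 s2).
Qed.

Lemma smooth_moved_proj : smooth_mx_on xt_dirs A pt.
Proof.
have sT : smooth_mx_on xt_dirs A (transition E al1 al2 p).
  by apply: smooth_transition => z /gA [].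
have sTV : smooth_mx_on xt_dirs A (fun z => invmx (transition E al1 al2 p z)).
  by apply: (smoothM_invmx oA) => // z /gA [].
apply: (smoothM_ext oA _ (smoothMM oA (smoothMM oA sT (smoothM_cst p oA)) sTV)).
by move=> z /gA gz; rewrite /pt (dressable_moved_proj pp gz).
Qed.

(** Differentiating [moved_proj_img] gives the block of the derivative D with
    values in the kernel of the projection, [moved_proj_ker] that with values in
    its image. *)
Lemma pderiv_moved_proj v z U1 U2 : v \in (xt_dirs : seq (R * R)) -> A z ->
  pderiv v (fun w => E w al1) z = E z al1 * U1 ->
  pderiv v (fun w => E w al2) z = E z al2 * U2 ->
  pderiv v pt z = pt z * U2 * (1 - pt z) - (1 - pt z) * U1 * pt z.
Proof.
move=> vd Az e1 e2; have sp := smooth_moved_proj.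
have sc (X : M) := smoothM_cst X oA.
have H1 : (1 - p) * E z al1 * (U1 * pt z + pderiv v pt z) = 0.
  have := pderiv_ext oA v (fun w (Aw : A w) => moved_proj_img pp (gA Aw)) Az.
  have s1 : smooth_mx_on xt_dirs A (fun w => (1 - p) *m E w al1).
    exact: (smoothMM oA (sc _) (sE al1)).
  rewrite (pderivM oA vd Az s1 sp) (pderivM oA vd Az (sc (1 - p)) (sE al1)).
  rewrite !pderiv_cst mul0mx add0r e1 !mulmxE => <-.
  by rewrite mulrDr !mulrA.
have H2 : p * E z al2 * (U2 * (1 - pt z) - pderiv v pt z) = 0.
  have := pderiv_ext oA v (fun w (Aw : A w) => moved_proj_ker pp (gA Aw)) Az.
  have s1 : smooth_mx_on xt_dirs A (fun w => p *m E w al2).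
    exact: (smoothMM oA (sc _) (sE al2)).
  have s2 : smooth_mx_on xt_dirs A (fun w => 1 - pt w) by exact: (smoothMB oA (sc _) sp).
  rewrite (pderivM oA vd Az s1 s2) (pderivM oA vd Az (sc p) (sE al2)).
  rewrite (pderivB oA vd Az (sc 1) sp).
  rewrite !pderiv_cst mul0mx add0r sub0r e2 !mulmxE => <-.
  by rewrite mulrBr mulrN !mulrA.
have := moved_proj_fix pp (gA Az) H1; have := moved_proj_kill pp (gA Az) H2.
rewrite -!/(pt z); move: (pderiv v pt z) (pt z) => D q.
rewrite mulrBr => /eqP; rewrite subr_eq0 => /eqP qD.
rewrite mulrDr -qD => H.
have -> : D = q * (U1 * q) + q * (U2 * (1 - q)) - U1 * q by rewrite H addrC addKr.
by rewrite mulrBl mul1r mulrBl opprB !mulrA [_ + q * U2 * _]addrC -addrA.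
Qed.

End MovedProjectionDerivative.

Section DressedFrame.
Context {K : comNzRingType} {n : nat}.
Local Notation M := ('M[K]_n.+1).
Implicit Types (p q E F U W D : M) (s : K).

(** The remainder in [lpoly_gauged] does not depend on lambda. It is evaluated on
    the image of q at lambda = al1 and on its kernel at lambda = al2, where
    lambda - X vanishes. *)
Lemma gauged_remainder j (s : nat -> M) (al1 al2 : K) q D :
  q * q = q ->
  D = q * lpoly j s al2 * (1 - q) - (1 - q) * lpoly j s al1 * q ->
  let X := al2%:M + (al1 - al2) *: q in
  X * s j - gauged X s j * X = (al1 - al2) *: D.
Proof.
move=> qq DE X; set k := _ - _.
have N1 : al1%:M - X = (al1 - al2) *: (1 - q).
  rewrite /X opprD addrA scalerBr; congr (_ - _).
  by rewrite -raddfB /= -scalemx1.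
have N2 : al2%:M - X = - ((al1 - al2) *: q) by rewrite /X opprD addrA subrr sub0r.
have q1 : (1 - q) * q = 0 by rewrite mulrBl mul1r qq subrr.
have q2 : q * (1 - q) = 0 by rewrite mulrBr mulr1 qq subrr.
have kE l : k = lpoly j (gauged X s) l * (l%:M - X) - (l%:M - X) * lpoly j s l.
  by rewrite lpoly_gauged addrC addKr.
have k1 : k * q = - ((al1 - al2) *: ((1 - q) * lpoly j s al1 * q)).
  rewrite (kE al1) N1 mulrBl -scalerAr -!scalerAl -(mulrA _ (1 - q) q) q1.
  by rewrite mulr0 scaler0 sub0r.
have k2 : k * (1 - q) = (al1 - al2) *: (q * lpoly j s al2 * (1 - q)).
  rewrite (kE al2) N2 mulrN mulNr opprK mulrDl mulNr -scalerAr -!scalerAl.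
  by rewrite -(mulrA _ q (1 - q)) q2 mulr0 scaler0 oppr0 add0r.
rewrite -[LHS]mulr1 -[1 in LHS](subrK q) mulrDr k1 k2.
by rewrite DE scalerBr.
Qed.

(** Here lambda - X = s q and its value at (0, 0) is s p, both singular. The
    left-hand side is the derivative of the frame on the right, when E_v = E U
    and F_v = F U + E U', with F and U' derivatives in lambda, and D = q_v. The
    matrices W and W' are those of the dressed system: the last two hypotheses
    are [lpoly_gauged] divided by s, and [dlpoly_gauged]. *)
Lemma special_frame p q E F U U' W W' D s :
  q * q = q -> p * E * (1 - q) = 0 -> q * D * q = 0 ->
  D = q * U - W * q ->
  s *: (W' * q) + W = s *: (q * U') + U ->
  p * (E * U) + (E * U * (1 - q) - E * D) +
    s *: (p * (F * U + E * U') * (1 - q) - p * F * D) =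
  (p * E + E * (1 - q) + s *: (p * F * (1 - q))) * W.
Proof.
move=> qq pE qDq DE I2; have [T TU] : exists T, T = U - W by exists (U - W).
have WT : W = U - T by rewrite TU opprB addrC subrK.
have TE : T = s *: (W' * q) - s *: (q * U').
  by apply/eqP; rewrite TU subr_eq addrAC I2 [_ + U]addrC addrK.
have qTq : q * T * q = 0.
  rewrite -qDq DE TU !mulrBr !mulrBl !mulrA qq; congr (_ - _).
  by rewrite -!mulrA qq.
have W0 : s *: (q * W' * q) = s *: (q * U' * q).
  apply/eqP; rewrite -subr_eq0 -qTq TE mulrBr mulrBl -!scalerAr -!scalerAl !mulrA qq.
  by rewrite -(mulrA _ q q) qq.
have Tq : T * q = s *: (W' * q) - s *: (q * W' * q).
  by rewrite TE mulrBl -!scalerAl -(mulrA _ q q) qq W0.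
have qT : q * T = s *: (q * W' * q) - s *: (q * U').
  by rewrite TE mulrBr -!scalerAr !mulrA qq.
have a1 : T * q = (1 - q) * T.
  by rewrite mulrBl mul1r qT Tq {1}TE opprB addrA subrK.
have a2 : q * T = - (s *: (q * U' * (1 - q))).
  by rewrite qT W0 mulrBr mulr1 scalerBr opprB.
have k : U * (1 - q) - D = (1 - q) * W.
  have z (x y w t : M) : x - y - (w - (y - t)) = x - w - t.
    by rewrite opprB addrA addrA subrK addrAC.
  by rewrite DE WT [RHS]mulrBr -a1 mulrBr mulr1 mulrBl z mulrBl mul1r.
have pEq : p * E = p * E * q.
  by move: pE; rewrite mulrBr mulr1 => /eqP; rewrite subr_eq0 => /eqP.
have b : p * (E * U) + s *: (p * (E * U') * (1 - q)) = p * E * W.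
  rewrite WT [RHS]mulrBr (mulrA p E U); congr (_ + _).
  rewrite [in RHS]pEq -(mulrA (p * E) q T) a2 mulrN opprK -scalerAr.
  by rewrite (mulrA (p * E)) (mulrA (p * E)) -pEq !mulrA.
have c (Y : M) : Y * U * (1 - q) - Y * D = Y * (1 - q) * W.
  by rewrite -!mulrA -mulrBr k.
rewrite c !mulrDl -scalerAl -(c (p * F)) -b (mulrDr p) mulrDl -!addrA; congr (_ + _).
rewrite [RHS]addrCA; congr (_ + _).
by rewrite -scalerDr addrCA !mulrA.
Qed.

End DressedFrame.

(** * The linear system and its derivative in lambda *)

Section GaugeRecursion.
Context {K : comNzRingType} {n : nat}.
Local Notation M := ('M[K]_n.+1).

Lemma mx_addE (A B : M) i k : (A + B) i k = A i k + B i k. Proof. exact: mxE. Qed.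
Lemma mx_oppE (A : M) i k : (- A) i k = - A i k. Proof. exact: mxE. Qed.

(** Induction step for the recursion of the dressed potential u1: a gauge
    transformation by 1 - X / lambda with X_x = X u - u1 X sends solutions of
    the Lax equation of u to solutions of that of u1. *)
Lemma gauged_rec_step (a u u1 X Q0 Q1 Q2 s0 s1 dQ0 dQ1 ds0 dX : M) :
  u1 = u - X * a + a * X -> dX = X * u - u1 * X ->
  dQ0 + (u * Q0 - Q0 * u) = Q1 * a - a * Q1 ->
  dQ1 + (u * Q1 - Q1 * u) = Q2 * a - a * Q2 ->
  s1 = Q1 - X * Q0 + s0 * X ->
  ds0 + (u1 * s0 - s0 * u1) = s1 * a - a * s1 ->
  dQ1 - (dX * Q0 + X * dQ0) + (ds0 * X + s0 * dX) + (u1 * s1 - s1 * u1) =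
    (Q2 - X * Q1 + s1 * X) * a - a * (Q2 - X * Q1 + s1 * X).
Proof.
move=> u1E dXE /(canRL (addrK _)) -> /(canRL (addrK _)) -> s1E /(canRL (addrK _)) ->.
rewrite dXE {}s1E {}u1E.
rewrite !(mulrDl, mulrDr, mulrN, mulNr, opprD, opprK, mulrA).
by apply/matrixP => i k; rewrite !(mx_addE, mx_oppE); ring.
Qed.

Lemma gauged_rec_start (a u u1 X b Q1 : M) : a * b = b * a ->
  u1 = u - X * a + a * X -> u * b - b * u = Q1 * a - a * Q1 ->
  u1 * b - b * u1 = (Q1 - X * b + b * X) * a - a * (Q1 - X * b + b * X).
Proof.
move=> ab -> H; rewrite !(mulrDl, mulrDr, mulrN, mulNr, opprD, opprK, mulrA).
have -> : Q1 * a = u * b - b * u + a * Q1 by rewrite H subrK.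
have -> : X * a * b = X * b * a by rewrite -!mulrA ab.
rewrite ab; apply/matrixP => i k; rewrite !(mx_addE, mx_oppE).
by ring.
Qed.

End GaugeRecursion.

Section LambdaPolynomialDerivative.
Context {R : realType} {n : nat} (A : set (R * R)) (oA : open A).
Local Notation M := ('M[R[i]]_n.+1).
Context (s : nat -> R * R -> M) (l : R[i]).
Hypothesis ss : forall k, smooth_mx_on xt_dirs A (s k).

Lemma smooth_lpoly j : smooth_mx_on xt_dirs A (fun z => lpoly j (s^~ z) l).
Proof.
elim: j => [|j IH] /=; first exact: ss.
exact: (smoothMD oA (smoothMZl oA l IH) (ss j.+1)).
Qed.

Lemma smooth_dlpoly j : smooth_mx_on xt_dirs A (fun z => dlpoly j (s^~ z) l).
Proof.
elim: j => [|j IH] /=; first exact: smoothM_cst.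
exact: (smoothMD oA (smoothMZl oA l IH) (smooth_lpoly j)).
Qed.

Lemma pderiv_lpoly j v z : v \in (xt_dirs : seq (R * R)) -> A z ->
  pderiv v (fun z => lpoly j (s^~ z) l) z =
  lpoly j (fun k => pderiv v (s k) z) l.
Proof.
move=> vd Az; elim: j => [|j IH] //=.
rewrite (pderivD vd Az (smoothMZl oA l (smooth_lpoly j)) (ss j.+1)).
by rewrite (pderivZ oA vd Az l (smooth_lpoly j)) IH.
Qed.

Lemma pderiv_dlpoly j v z : v \in (xt_dirs : seq (R * R)) -> A z ->
  pderiv v (fun z => dlpoly j (s^~ z) l) z =
  dlpoly j (fun k => pderiv v (s k) z) l.
Proof.
move=> vd Az; elim: j => [|j IH] /=; first by rewrite pderiv_cst.
rewrite (pderivD vd Az (smoothMZl oA l (smooth_dlpoly j)) (smooth_lpoly j)).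
by rewrite (pderivZ oA vd Az l (smooth_dlpoly j)) IH pderiv_lpoly.
Qed.

End LambdaPolynomialDerivative.

Section Connection.
Context {R : realType} {n : nat}.
Local Notation C := (R[i]).
Local Notation M := ('M[R[i]]_n.+1).
Context (a : M) (da : is_diag_mx a) (q : {poly R[i]}).
Context (Q : nat -> (nat -> M) -> M) (hQ : Q_sequence a (horner_mx a q) Q).
Context (j : nat).
Implicit Types (u : R * R -> M) (E : R * R -> C -> M) (v z : R * R) (l : C).

Lemma dir_t_neq_x : ((dir_t : R * R) == dir_x) = false.
Proof. by apply/eqP => -[/eqP]; rewrite eq_sym oner_eq0. Qed.

Definition conn_deg v : nat := if v == dir_x then 1%N else j.

Definition conn_seq u v : nat -> R * R -> M :=
  if v == dir_x then fun k z => match k with 0%N => a | 1%N => u z | _ => 0 end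
  else fun k z => Q k (jet u z).

(** E^-1 E_v for a trivialization E of u. Both equations of the linear system are
    of the form lpoly, with coefficients (a, u) in the direction x and Q(u) in
    the direction t, so they are dressed in the same way. *)
Definition conn u v z l : M := lpoly (conn_deg v) ((conn_seq u v)^~ z) l.

Definition dconn u v z l : M := dlpoly (conn_deg v) ((conn_seq u v)^~ z) l.

Lemma conn_x u z l : conn u dir_x z l = l *: a + u z.
Proof. by rewrite /conn /conn_deg /conn_seq eqxx. Qed.

Lemma conn_t u z l : conn u dir_t z l = \sum_(k < j.+1) l ^+ (j - k) *: Q k (jet u z).
Proof. by rewrite /conn /conn_deg /conn_seq dir_t_neq_x lpolyE. Qed.

Lemma triv_conn O u E v l z : trivialization a Q j O u E ->
  v \in (xt_dirs : seq (R * R)) -> O z ->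
  pderiv v (fun w => E w l) z = E z l * conn u v z l.
Proof.
move=> tE; rewrite !inE => /orP[]/eqP -> Oz.
  by rewrite (triv_x tE) // conn_x.
by rewrite (triv_t tE) // conn_t.
Qed.

Lemma triv_intro O u E :
  (forall l, smooth_mx_on xt_dirs O (fun z => E z l)) ->
  (forall l, E (0, 0) l = 1%:M) ->
  (forall v l z, v \in (xt_dirs : seq (R * R)) -> O z ->
     pderiv v (fun w => E w l) z = E z l * conn u v z l) ->
  trivialization a Q j O u E.
Proof.
move=> sE E0 dE; split => // l z Oz.
  by rewrite dE ?dir_x_in // conn_x.
by rewrite dE ?dir_t_in // conn_t.
Qed.

Lemma triv_sub O B u E : B `<=` O -> trivialization a Q j O u E ->
  trivialization a Q j B u E.
Proof.
move=> BO tE; split.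
- by move=> l; apply: (smoothM_sub BO); exact: (triv_smooth tE).
- by move=> l z /BO; exact: (triv_x tE).
- by move=> l z /BO; exact: (triv_t tE).
- exact: (triv_0 tE).
Qed.

Context (O : set (R * R)) (oO : open O) (u : R * R -> M).
Hypotheses (su : smooth_mx_on xt_dirs O u) (pu : forall z, O z -> sl_perp a (u z)).

Lemma smooth_Qjet k : smooth_mx_on xt_dirs O (fun z => Q k (jet u z)).
Proof. exact: (lax_smooth (lax_Q hQ) k oO su). Qed.

Lemma smooth_conn_seq v k : smooth_mx_on xt_dirs O (conn_seq u v k).
Proof.
rewrite /conn_seq; case: ifP => _; last exact: smooth_Qjet.
by case: k => [|[|k]] //; exact: smoothM_cst.
Qed.

(** The zero curvature equation differentiated in lambda. By the recursion the
    right-hand side is a telescoping sum. *)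
Lemma dconn_closed z l : O z ->
  conn u dir_t z l * a - a * conn u dir_t z l =
  pderiv dir_x (fun w => dconn u dir_t w l) z +
  (conn u dir_x z l * dconn u dir_t z l - dconn u dir_t z l * conn u dir_x z l).
Proof.
move=> Oz; rewrite /dconn (pderiv_dlpoly oO _ (smooth_conn_seq dir_t)) ?dir_x_in //.
rewrite conn_x /conn /conn_deg /conn_seq dir_t_neq_x.
pose s k := Q k (jet u z); rewrite -!/(s _).
pose d k := s k * a - a * s k.
have d0 : d 0%N = 0 by rewrite /d /s (Q_zero hQ) horner_mx_comm subrr.
have e : (fun k => pderiv dir_x (fun w => Q k (jet u w)) z) =
    fun k => d k.+1 - (u z * s k - s k * u z).
  apply/funext => k; rewrite /d; have := Q_recursion hQ oO su pu k Oz.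
  by move=> /(canRL (addrK _)).
pose D := dlpoly j s l; pose P := dlpoly j (fun k => d k.+1) l.
have e1 : dlpoly j (fun k => d k.+1 - (u z * s k - s k * u z)) l =
    P - (u z * D - D * u z).
  rewrite (dlpolyB j (fun k => d k.+1)) (dlpolyB j (fun k => u z * s k)).
  by rewrite dlpoly_mull dlpoly_mulr.
have e2 : lpoly j s l * a - a * lpoly j s l = P - l *: (D * a - a * D).
  rewrite -lpoly_mulr -lpoly_mull -lpolyB -(dlpoly_telescope j l d0).
  rewrite (dlpolyB j (fun k => d k.+1)) dlpolyZ (dlpolyB j (fun k => s k * a)).
  by rewrite dlpoly_mull dlpoly_mulr.
rewrite e e1 e2 mulrDl mulrDr -scalerAl -scalerAr scalerBr.
by apply/matrixP => i k; rewrite !(mx_addE, mx_oppE); ring.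
Qed.

(** Variation of constants: F = G E, where G is a primitive of the 1-form with
    components E (dconn) E^-1, closed by [dconn_closed]. *)
Lemma lambda_derivative E (l : C) (r rho : R) :
  0 < rho -> rho < r -> ball ((0, 0) : R * R) r `<=` O ->
  trivialization a Q j O u E ->
  (forall z, ball ((0, 0) : R * R) r z -> E z l \in unitmx) ->
  exists F : R * R -> M,
    [/\ smooth_mx_on xt_dirs (ball ((0, 0) : R * R) rho) F, F (0, 0) = 0 &
     forall v z, v \in (xt_dirs : seq (R * R)) -> ball ((0, 0) : R * R) rho z ->
       pderiv v F z = F z * conn u v z l + E z l * dconn u v z l].
Proof.
move=> rho0 rhor; set B := ball _ r; set B' := ball _ rho => BO tE uE.
have oB : open B by exact: ball_open.
have oB' : open B' by exact: ball_open.
have B'B : B' `<=` B.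
  by move=> z /ball0E[z1 z2]; apply/ball0E; split; apply: lt_trans rhor.
have sE : smooth_mx_on xt_dirs B (fun z => E z l).
  by apply: (smoothM_sub BO); exact: (triv_smooth tE).
have sV : smooth_mx_on xt_dirs B (fun z => invmx (E z l)).
  exact: (smoothM_invmx oB uE sE).
have sd v : smooth_mx_on xt_dirs B (fun z => dconn u v z l).
  apply: (smooth_dlpoly oB l) => k; apply: (smoothM_sub BO).
  exact: smooth_conn_seq.
pose F1 v z := E z l *m dconn u v z l *m invmx (E z l).
have sF v : smooth_mx_on xt_dirs B (F1 v).
  exact: (smoothMM oB (smoothMM oB sE (sd v)) sV).
have dF v w z : w \in (xt_dirs : seq (R * R)) -> B z -> pderiv w (F1 v) z =
    E z l * (pderiv w (fun y => dconn u v y l) z +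
       (conn u w z l * dconn u v z l - dconn u v z l * conn u w z l)) * invmx (E z l).
  move=> wd Bz.
  rewrite (pderivM oB wd Bz (smoothMM oB sE (sd v)) sV) (pderivM oB wd Bz sE (sd v)).
  rewrite (pderiv_invmx oB wd uE sE Bz) (triv_conn _ tE wd (BO _ Bz)) !mulmxE.
  rewrite !mulrA -[invmx (E z l) * E z l]/(invmx _ *m _) mulVmx ?uE // mul1r.
  rewrite mulrN !mulrDr !mulrDl !mulrN !mulNr !mulrA.
  by apply/matrixP => i k; rewrite !(mx_addE, mx_oppE); ring.
have dx z : dconn u dir_x z l = a.
  by rewrite /dconn /conn_deg /conn_seq eqxx /= scaler0 add0r.
have [z Bz|G [sG G0 Gx Gt]] := poincare_mx rho0 rhor (sF dir_x) (sF dir_t).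
  rewrite (dF dir_x dir_t z dir_t_in Bz) (dF dir_t dir_x z dir_x_in Bz).
  rewrite -(dconn_closed l (BO z Bz)) dx; congr (_ * _ * _).
  rewrite (pderiv_ext oB (G := fun=> a) dir_t (fun y _ => dx y) Bz).
  by rewrite pderiv_cst add0r.
have sE' : smooth_mx_on xt_dirs B' (fun z => E z l) by exact: (smoothM_sub B'B sE).
exists (fun z => G z *m E z l); split.
- exact: (smoothMM oB' sG sE').
- by rewrite G0 mul0mx.
move=> v z vd Bz; rewrite (pderivM oB' vd Bz sG sE').
rewrite (triv_conn _ tE vd (BO _ (B'B _ Bz))) !mulmxE addrC mulrA; congr (_ + _).
have -> : pderiv v G z = F1 v z.
  by move: vd; rewrite !inE => /orP[]/eqP ->; [exact: Gx|exact: Gt].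
rewrite /F1 mulmxE -!mulrA -[invmx (E z l) * E z l]/(invmx _ *m _) mulVmx ?uE ?mulr1 //.
exact: B'B.
Qed.

End Connection.

(** * Dressed trivializations *)

Lemma moved_proj_at0 {R : realType} {n : nat} (a : 'M[R[i]]_n.+1) Q j O u
    (E : R * R -> R[i] -> 'M[R[i]]_n.+1) (b1 b2 : R[i]) p :
  p * p = p -> trivialization a Q j O u E -> dressable E b1 b2 p (0, 0) ->
  moved_proj E b1 b2 p (0, 0) = p.
Proof.
move=> pp tE g0; apply: (moved_proj_unique pp g0).
  by rewrite (triv_0 tE) mulr1 mulrBl mul1r pp subrr.
by rewrite (triv_0 tE) mulr1 mulrBr mulr1 pp subrr.
Qed.

Section Dressing.
Context {R : realType} {n : nat}.
Local Notation C := (R[i]).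
Local Notation M := ('M[R[i]]_n.+1).
Context (a : M) (da : is_diag_mx a) (q : {poly R[i]}).
Context (Q : nat -> (nat -> M) -> M) (hQ : Q_sequence a (horner_mx a q) Q).
Context (j : nat).
Context (O : set (R * R)) (oO : open O) (u : R * R -> M).
Hypotheses (su : smooth_mx_on xt_dirs O u) (pu : forall z, O z -> sl_perp a (u z)).
Context (E : R * R -> C -> M) (tE : trivialization a Q j O u E).
Context (al1 al2 : C) (p : M).
Hypothesis pp : p * p = p.
Context (r : R).
Let B := ball ((0, 0) : R * R) r.
Hypotheses (BO : B `<=` O) (gB : forall z, B z -> dressable E al1 al2 p z).
Implicit Types (v z : R * R) (l : C).

Let oB : open B. Proof. exact: ball_open. Qed.

Let pt := moved_proj E al1 al2 p.
Let u1 := dress a E al1 al2 p u.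

(** alpha_2 + (alpha_1 - alpha_2) pi: the simple element with this data is
    (lambda - elt_root) / (lambda - alpha_1). *)
Definition elt_root (b1 b2 : C) (x : M) : M := b2%:M + (b1 - b2) *: x.

Let X z := elt_root al1 al2 (pt z).

Let sE l : smooth_mx_on xt_dirs B (fun z => E z l).
Proof. by apply: (smoothM_sub BO); exact: (triv_smooth tE). Qed.

Let spt : smooth_mx_on xt_dirs B pt.
Proof. exact: (smooth_moved_proj pp oB gB sE). Qed.

Let sX : smooth_mx_on xt_dirs B X.
Proof. exact: (smoothMD oB (smoothM_cst _ oB) (smoothMZl oB (al1 - al2) spt)). Qed.

Lemma dress_elt_root z : u1 z = u z - X z * a + a * X z.
Proof.
rewrite /u1 /dress /X /elt_root /lie mulrDl mulrDr -scalerAl -scalerAr.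
rewrite -!mulmxE scalar_mxC scalerBr; apply/matrixP => i k; rewrite !(mx_addE, mx_oppE); ring.
Qed.

Lemma smooth_dress : smooth_mx_on xt_dirs B u1.
Proof.
apply: (smoothMD oB (smoothM_sub BO su)).
exact: (smoothMZl oB (al1 - al2) (smoothM_lie oB (smoothM_cst a oB) spt)).
Qed.

Lemma perp_dress z : B z -> sl_perp a (u1 z).
Proof.
move=> Bz; apply/(sl_perpP _ da) => i k aik.
rewrite /u1 /dress mx_addE ((sl_perpP _ da).1 (pu (BO Bz)) i k aik) add0r.
by rewrite mxE lie_diagE // aik subrr mul0r mulr0.
Qed.

Lemma pderiv_elt_root v z : v \in (xt_dirs : seq (R * R)) -> B z ->
  pderiv v X z = X z * conn_seq a Q u v (conn_deg j v) z -
    gauged (X z) ((conn_seq a Q u v)^~ z) (conn_deg j v) * X z.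
Proof.
move=> vd Bz.
rewrite (pderivD vd Bz (smoothM_cst _ oB) (smoothMZl oB (al1 - al2) spt)).
rewrite pderiv_cst add0r (pderivZ oB vd Bz (al1 - al2) spt).
have D := pderiv_moved_proj pp oB gB sE vd Bz (triv_conn al1 tE vd (BO Bz))
  (triv_conn al2 tE vd (BO Bz)).
exact/esym/(gauged_remainder (moved_proj_idem pp (gB Bz)) D).
Qed.

Let gQ k z := gauged (X z) (fun i => Q i (jet u z)) k.

Let sQ k : smooth_mx_on xt_dirs B (fun z => Q k (jet u z)).
Proof. exact: (smoothM_sub BO (smooth_Qjet hQ oO su k)). Qed.

Let sgQ k : smooth_mx_on xt_dirs B (gQ k).
Proof.
elim: k => [|k IH]; first exact: sQ.
exact: (smoothMD oB (smoothMB oB (sQ k.+1) (smoothMM oB sX (sQ k)))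
  (smoothMM oB IH sX)).
Qed.

Let gQ_rec k z : B z ->
  pderiv dir_x (gQ k) z + lie (u1 z) (gQ k z) = lie (gQ k.+1 z) a.
Proof.
move=> Bz; elim: k => [|k IH].
  rewrite (pderiv_ext oB (G := fun=> horner_mx a q) dir_x _ Bz) => [|y _]; last first.
    by rewrite /gQ /= (Q_zero hQ).
  rewrite pderiv_cst add0r /gQ /= (Q_zero hQ).
  apply: (@gauged_rec_start _ _ a (u z)); first by rewrite horner_mx_comm.
    exact: dress_elt_root.
  have := Q_recursion hQ oO su pu 0 (BO Bz).
  rewrite (_ : (fun w => Q 0%N (jet u w)) = fun=> horner_mx a q); last first.
    by apply/funext => w; exact: (Q_zero hQ).
  by rewrite pderiv_cst add0r (Q_zero hQ).
have dXE : pderiv dir_x X z = X z * u z - u1 z * X z.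
  rewrite (pderiv_elt_root dir_x_in Bz) /conn_deg /conn_seq eqxx /=.
  by rewrite -dress_elt_root.
have D : pderiv dir_x (gQ k.+1) z = pderiv dir_x (fun w => Q k.+1 (jet u w)) z -
    (pderiv dir_x X z * Q k (jet u z) + X z * pderiv dir_x (fun w => Q k (jet u w)) z) +
    (pderiv dir_x (gQ k) z * X z + gQ k z * pderiv dir_x X z).
  have sXQ := smoothMM oB sX (sQ k).
  have e1 := pderivD dir_x_in Bz (smoothMB oB (sQ k.+1) sXQ) (smoothMM oB (sgQ k) sX).
  have e2 := pderivB oB dir_x_in Bz (sQ k.+1) sXQ.
  rewrite (pderivM oB dir_x_in Bz sX (sQ k)) in e2.
  rewrite e2 (pderivM oB dir_x_in Bz (sgQ k) sX) in e1.
  exact: e1.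
rewrite D.
exact: (gauged_rec_step (dress_elt_root z) dXE
  (Q_recursion hQ oO su pu k (BO Bz)) (Q_recursion hQ oO su pu k.+1 (BO Bz))
  erefl IH).
Qed.

(** Conjugation preserves both the Lax equation and the annihilation by the roots
    of b, so [lax_unique] applies. *)
Lemma gauged_Q k z : B z -> gauged (X z) (fun i => Q i (jet u z)) k = Q k (jet u1 z).
Proof.
have [rt urt rt0] := horner_root_diag q da.
apply: (lax_unique (s := gQ) da hQ urt rt0 oB smooth_dress perp_dress).
- by move=> w _; rewrite /gQ /= (Q_zero hQ).
- move=> w Bw; apply: (gauge_eq0 (x := X w) (s := annihilate rt (fun i => Q i (jet u w)))).
    by apply: gauge_annihilate; apply: gaugeP.
  move=> i; apply: (lax_eq0 (S := fun k J => annihilate rt (fun i => Q i J) k)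
    da (lax_annihilate rt (lax_Q hQ)) _ i oO su pu (BO Bw)).
  by move=> J; rewrite annihilate0 (Q_zero hQ).
- by move=> i w Bw; exact: gQ_rec.
Qed.

Lemma conn_dress v z l : v \in (xt_dirs : seq (R * R)) -> B z ->
  conn a Q j u1 v z l = lpoly (conn_deg j v) (gauged (X z) ((conn_seq a Q u v)^~ z)) l.
Proof.
move=> vd Bz; rewrite /conn /conn_seq; move: vd; rewrite !inE => /orP[]/eqP ->.
  by rewrite /conn_deg eqxx /= dress_elt_root.
rewrite dir_t_neq_x; congr lpoly; apply/funext => k.
by rewrite -gauged_Q.
Qed.

Lemma elt_root_0 : B (0, 0) -> X (0, 0) = elt_root al1 al2 p.
Proof.
by move=> B0; rewrite /X /pt (moved_proj_at0 pp tE (gB B0)).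
Qed.

(** The dressed trivialization at a single value l of lambda. *)
Definition dressed_frame (A : set (R * R)) l (F : R * R -> M) : Prop :=
  [/\ smooth_mx_on xt_dirs A F, F (0, 0) = 1%:M,
    forall v z, v \in (xt_dirs : seq (R * R)) -> A z ->
      pderiv v F z = F z * conn a Q j u1 v z l &
    forall z, A z -> F z * (l%:M - X z) = (l%:M - elt_root al1 al2 p) * E z l].

Lemma elt_root_factor l z : B z ->
  (l%:M - X z) * (l%:M - elt_root al2 al1 (pt z)) = ((l - al1) * (l - al2))%:M.
Proof.
move=> Bz; have qq := moved_proj_idem pp (gB Bz).
rewrite /X /elt_root -/(pt z) in qq *; move: (pt z) qq => x xx.
have e b1 b2 : l%:M - (b1%:M + b2 *: x) = (l - b1) *: (1 : M) - b2 *: x.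
  by rewrite opprD addrA -raddfB /= -[_%:M]scalemx1.
rewrite !e mulrBl !mulrBr -!scalerAl -!scalerAr !mul1r !mulr1 xx -[RHS]scalemx1.
rewrite -[1%:M]/(1 : M); move: (1 : M) => y; apply/matrixP => i k.
have scE c (Y : M) : (c *: Y) i k = c * Y i k by rewrite mxE.
by rewrite !(mx_addE, mx_oppE, scE); ring.
Qed.

(** The relation with E determines F. Its derivative is the dressed system
    multiplied by the invertible matrix lambda - X. *)
Lemma generic_frame l : B (0, 0) -> l != al1 -> l != al2 ->
  exists F, dressed_frame B l F.
Proof.
move=> B0 l1 l2.
have uN z : B z -> l%:M - X z \in unitmx.
  move=> Bz; have e := elt_root_factor l Bz.
  have : (l%:M - X z) *m (l%:M - elt_root al2 al1 (pt z)) \in unitmx.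
    rewrite [_ *m _]e -scalemx1 unitmxZ ?unitmx1 // unitfE.
    by rewrite mulf_neq0 // subr_eq0.
  by rewrite unitmx_mul => /andP[].
have sN : smooth_mx_on xt_dirs B (fun z => l%:M - X z).
  exact: (smoothMB oB (smoothM_cst _ oB) sX).
pose F z := (l%:M - elt_root al1 al2 p) *m E z l *m invmx (l%:M - X z).
have sL : smooth_mx_on xt_dirs B (fun z => (l%:M - elt_root al1 al2 p) *m E z l).
  exact: (smoothMM oB (smoothM_cst _ oB) (sE l)).
have sF : smooth_mx_on xt_dirs B F.
  exact: (smoothMM oB sL (smoothM_invmx oB uN sN)).
have FN z : B z -> F z *m (l%:M - X z) = (l%:M - elt_root al1 al2 p) *m E z l.
  by move=> Bz; rewrite /F mulmxKV // uN.
exists F; split => //.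
- rewrite /F (triv_0 tE) mulmx1 -elt_root_0 // mulmxV //; exact: uN.
- move=> v z vd Bz; apply: (can_inj (mulmxK (uN z Bz))).
  have := pderiv_ext oB v FN Bz.
  rewrite (pderivM oB vd Bz sF sN) (pderivM oB vd Bz (smoothM_cst _ oB) (sE l)).
  rewrite (pderivB oB vd Bz (smoothM_cst _ oB) sX) !pderiv_cst mul0mx !add0r.
  rewrite (triv_conn l tE vd (BO Bz)) mulmxN => /eqP; rewrite subr_eq => /eqP ->.
  rewrite !mulmxE mulrA -[_ * E z l]FN // !mulmxE -(mulrA (F z)) -mulrDr -mulrA.
  by rewrite conn_dress // pderiv_elt_root // lpoly_gauged.
Qed.

(** For l = al1 and l = al2, where lambda - X is a multiple of a projection q0.
    The ball shrinks as the derivative F of E in lambda is only integrated on a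
    smaller square. *)
Lemma special_frame_exists (rho : R) l (s : C) (p0 : M) (q0 : R * R -> M) :
  0 < rho -> rho < r -> let B' := ball ((0, 0) : R * R) rho in
  smooth_mx_on xt_dirs B q0 -> s != 0 ->
  (forall z, B z -> E z l \in unitmx) ->
  (forall z, B z -> l%:M - X z = s *: q0 z) ->
  l%:M - elt_root al1 al2 p = s *: p0 ->
  (forall z, B z -> q0 z * q0 z = q0 z) ->
  (forall z, B z -> p0 * E z l * (1 - q0 z) = 0) ->
  exists F, dressed_frame B' l F.
Proof.
move=> rho0 rhor B' sq s0 uE XE pE qq pEq.
have B'B : B' `<=` B.
  by move=> z /ball0E[z1 z2]; apply/ball0E; split; apply: lt_trans rhor.
have oB' : open B' by exact: ball_open.
have B'0 : B' (0, 0) by exact: ballxx.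
have [F [sF F0 dF]] := lambda_derivative hQ oO su pu rho0 rhor BO tE uE.
have c (Y : M) := smoothM_cst Y oB'.
have sq' := smoothM_sub B'B sq; have sE' := smoothM_sub B'B (sE l).
have sq1 : smooth_mx_on xt_dirs B' (fun z => 1 - q0 z) := smoothMB oB' (c 1) sq'.
have s1 : smooth_mx_on xt_dirs B' (fun z => p0 *m E z l) := smoothMM oB' (c p0) sE'.
have s2 : smooth_mx_on xt_dirs B' (fun z => E z l *m (1 - q0 z)) := smoothMM oB' sE' sq1.
have s3 : smooth_mx_on xt_dirs B' (fun z => p0 *m F z) := smoothMM oB' (c p0) sF.
have s4 : smooth_mx_on xt_dirs B' (fun z => p0 *m F z *m (1 - q0 z)) := smoothMM oB' s3 sq1.
have s5 : smooth_mx_on xt_dirs B' (fun z => s *: (p0 *m F z *m (1 - q0 z))) := smoothMZl oB' s s4.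
have s12 := smoothMD oB' s1 s2.
have q00 : q0 (0, 0) = p0.
  by apply: (scalerI s0); rewrite -XE ?elt_root_0 //; exact: B'B.
exists (fun z => (p0 *m E z l + E z l *m (1 - q0 z)) + s *: (p0 *m F z *m (1 - q0 z))).
split.
- exact: (smoothMD oB' s12 s5).
- rewrite (triv_0 tE) F0 mulmx0 mul0mx scaler0 addr0 mulmx1 mul1mx q00.
  by rewrite addrC subrK.
- move=> v z vd Bz; have Bz1 := B'B _ Bz.
  rewrite (pderivD vd Bz s12 s5) (pderivD vd Bz s1 s2) (pderivZ oB' vd Bz s s4).
  rewrite (pderivM oB' vd Bz s3 sq1) (pderivM oB' vd Bz (c p0) sF).
  rewrite (pderivM oB' vd Bz (c p0) sE') (pderivM oB' vd Bz sE' sq1).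
  rewrite (pderivB oB' vd Bz (c 1) sq') !pderiv_cst !mul0mx !add0r !mulmxN.
  rewrite (triv_conn l tE vd (BO Bz1)) (dF v z vd Bz) conn_dress //.
  set D := pderiv v q0 z; set W := lpoly _ _ _.
  (* The derivative of a projection maps its image into its kernel. *)
  have qDq : q0 z * D * q0 z = 0.
    have := pderiv_ext oB' v (fun w Bw => qq w (B'B _ Bw)) Bz.
    rewrite (pderivM oB' vd Bz sq' sq') !mulmxE -/D => /(congr1 (fun Y => q0 z * Y * q0 z)).
    rewrite mulrDr mulrDl !mulrA qq // -[_ * D * q0 z * q0 z]mulrA qq //.
    by move=> /eqP; rewrite -subr_eq0 addrK => /eqP.
  have DE : D = q0 z * conn a Q j u v z l - W * q0 z.
    apply: (scalerI s0).
    have -> : s *: D = - pderiv v X z.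
      rewrite -(pderivZ oB' vd Bz s sq') -[RHS]sub0r -(pderiv_cst v (l%:M : M) z).
      rewrite -(pderivB oB vd Bz1 (smoothM_cst _ oB) sX).
      by apply: (pderiv_ext oB) => // w Bw; rewrite XE.
    rewrite (pderiv_elt_root vd Bz1).
    have := lpoly_gauged (conn_deg j v) (X z) ((conn_seq a Q u v)^~ z) l.
    rewrite -/W XE // -scalerAr -scalerAl => /esym/(canRL (addKr _)) ->.
    by rewrite opprD opprK scalerBr.
  have I2 := dlpoly_gauged (conn_deg j v) (X z) ((conn_seq a Q u v)^~ z) l.
  rewrite -/W XE // -scalerAr -scalerAl in I2.
  exact: (special_frame (F z) (qq z Bz1) (pEq z Bz1) qDq DE I2).
- move=> z Bz; have Bz1 := B'B _ Bz.
  rewrite XE // pE -scalerAr -scalerAl; congr (_ *: _).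
  rewrite !mulmxE !mulrDl -scalerAl -!mulrA.
  have q1 : (1 - q0 z) * q0 z = 0 by rewrite mulrBl mul1r qq // subrr.
  rewrite q1 !mulr0 scaler0 !addr0 mulrA.
  by have := pEq z Bz1; rewrite mulrBr mulr1 => /eqP; rewrite subr_eq0 => /eqP <-.
Qed.

End Dressing.

Section DressingTheorem.
Context {R : realType} {n : nat}.
Local Notation C := (R[i]).
Local Notation M := ('M[R[i]]_n.+1).
Context (a : M) (da : is_diag_mx a) (q : {poly R[i]}).
Context (Q : nat -> (nat -> M) -> M) (hQ : Q_sequence a (horner_mx a q) Q).
Context (j : nat).

Implicit Types (O : set (R * R)) (u : R * R -> M) (E : R * R -> C -> M) (p : M).

Lemma near0_ball (P : R * R -> Prop) : (\forall z \near ((0, 0) : R * R), P z) ->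
  exists r : R, 0 < r /\ forall z, ball ((0, 0) : R * R) r z -> P z.
Proof. by move=> /nbhs_ballP[r /= r0 rP]; exists r; split => // z /rP. Qed.

(** At (0, 0) both E and the transition matrix are the identity. *)
Lemma near_dressable O u E (b1 b2 : C) p : open O -> O (0, 0) ->
  trivialization a Q j O u E -> \forall z \near ((0, 0) : R * R), dressable E b1 b2 p z.
Proof.
move=> oO O0 tE.
have sE l : smooth_mx_on xt_dirs O (fun z => E z l) := triv_smooth tE l.
have E0 l : E (0, 0) l \in unitmx by rewrite (triv_0 tE) unitmx1.
have n1 : \forall z \near ((0, 0) : R * R), E z b1 \in unitmx /\ E z b2 \in unitmx.
  apply: filterI; [exact: (near_unitmx oO (sE b1) O0 (E0 b1))|].
  exact: (near_unitmx oO (sE b2) O0 (E0 b2)).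
have nO : \forall z \near ((0, 0) : R * R), O z by exact: open_nbhs_nbhs.
have [r [r0 rP]] := near0_ball (filterI nO n1).
have oB : open (ball ((0, 0) : R * R) r) by exact: ball_open.
have sT : smooth_mx_on xt_dirs (ball ((0, 0) : R * R) r) (transition E b1 b2 p).
  apply: (smooth_transition p oB).
    by move=> l; apply: (smoothM_sub _ (sE l)) => z /rP [].
  by move=> z /rP [].
have B0 : ball ((0, 0) : R * R) r (0, 0) by exact: ballxx.
have T0 : transition E b1 b2 p (0, 0) \in unitmx.
  rewrite /transition /moved1 /moved2 !(triv_0 tE) !invmx1 !mul1mx.
  by rewrite addrC subrK unitmx1.
have n2 := near_unitmx oB sT B0 T0.
by apply: filterS2 n1 n2 => z [] *; split.
Qed.

(** The frames for the different values of lambda need not be related, since a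
    trivialization is smooth in (x, t) for each lambda separately. If b1 = b2
    the simple element is the identity and E itself is taken. *)
Lemma dressing O u E (b1 b2 : C) p : open O -> O (0, 0) ->
  smooth_mx_on xt_dirs O u -> (forall z, O z -> sl_perp a (u z)) ->
  trivialization a Q j O u E -> p * p = p ->
  exists r : R, [/\ 0 < r, ball ((0, 0) : R * R) r `<=` O,
    forall z, ball ((0, 0) : R * R) r z -> dressable E b1 b2 p z &
    exists E1, trivialization a Q j (ball ((0, 0) : R * R) r)
        (dress a E b1 b2 p u) E1 /\
      forall l z, ball ((0, 0) : R * R) r z ->
        E1 z l * (l%:M - elt_root b1 b2 (moved_proj E b1 b2 p z)) =
        (l%:M - elt_root b1 b2 p) * E z l].
Proof.
move=> oO O0 su pu tE pp.
have nO : \forall z \near ((0, 0) : R * R), O z by exact: open_nbhs_nbhs.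
have [r [r0 rP]] := near0_ball (filterI nO (near_dressable b1 b2 p oO O0 tE)).
have BO : ball ((0, 0) : R * R) r `<=` O by move=> z /rP [].
have gB z : ball ((0, 0) : R * R) r z -> dressable E b1 b2 p z by move=> /rP [].
have oB : open (ball ((0, 0) : R * R) r) by exact: ball_open.
have B0 : ball ((0, 0) : R * R) r (0, 0) by exact: ballxx.
pose rho := r / 2.
have rho0 : 0 < rho by rewrite divr_gt0.
have rhor : rho < r by rewrite /rho ltr_pdivrMr // ltr_pMr // ltr1n.
have B'B : ball ((0, 0) : R * R) rho `<=` ball ((0, 0) : R * R) r.
  by apply: le_ball; exact: ltW.
have oB' : open (ball ((0, 0) : R * R) rho) by exact: ball_open.
exists rho; split => //.
- by move=> z /B'B /BO.
- by move=> z /B'B /gB.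
have [b12|b12] := eqVneq b1 b2.
  exists E; split.
    have -> : dress a E b1 b2 p u = u.
      by apply/funext => z; rewrite /dress b12 subrr scale0r addr0.
    by apply: triv_sub tE => z /B'B /BO.
  move=> l z _; rewrite /elt_root b12 subrr !scale0r !addr0 -raddfB /=.
  by rewrite -!mulmxE scalar_mxC.
have spt := smooth_moved_proj pp oB gB (fun l => smoothM_sub BO (triv_smooth tE l)).
have frame l : exists F, dressed_frame a Q j u E b1 b2 p (ball ((0, 0) : R * R) rho) l F.
  have rE c1 c2 c (x : M) : c%:M - elt_root c1 c2 x = (c - c2) *: 1 - (c1 - c2) *: x.
    by rewrite /elt_root opprD addrA -raddfB /= -[_%:M]scalemx1.
  have [->|l1] := eqVneq l b1.
    apply: (special_frame_exists da hQ oO su pu tE pp BO gB (s := b1 - b2)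
      (p0 := 1 - p) (q0 := fun z => 1 - moved_proj E b1 b2 p z) rho0 rhor).
    - exact: (smoothMB oB (smoothM_cst _ oB) spt).
    - by rewrite subr_eq0.
    - by move=> z /gB [].
    - by move=> z Bz; rewrite rE -scalerBr.
    - by rewrite rE -scalerBr.
    - move=> z Bz; rewrite mulrBr mulr1 mulrBl mul1r.
      by rewrite (moved_proj_idem pp (gB z Bz)) subrr subr0.
    - by move=> z Bz; rewrite subKr (moved_proj_img pp (gB z Bz)).
  have [->|l2] := eqVneq l b2.
    apply: (special_frame_exists da hQ oO su pu tE pp BO gB (s := b2 - b1)
      (p0 := p) (q0 := moved_proj E b1 b2 p) rho0 rhor).
    - exact: spt.
    - by rewrite subr_eq0 eq_sym.
    - by move=> z /gB [].
    - by move=> z Bz; rewrite rE subrr scale0r sub0r -scaleNr opprB.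
    - by rewrite rE subrr scale0r sub0r -scaleNr opprB.
    - by move=> z Bz; exact: (moved_proj_idem pp (gB z Bz)).
    - by move=> z Bz; exact: (moved_proj_ker pp (gB z Bz)).
  have [F [F1 F2 F3 F4]] := generic_frame da hQ oO su pu tE pp BO gB B0 l1 l2.
  exists F; split => //.
  - exact: (smoothM_sub B'B F1).
  - by move=> v z vd /B'B; exact: F3.
  - by move=> z /B'B; exact: F4.
have /choice[F HF] := frame.
exists (fun z l => F l z); split.
  apply: triv_intro.
  - by move=> l; have [] := HF l.
  - by move=> l; have [] := HF l.
  - by move=> v l z vd Bz; have [_ _ H _] := HF l; exact: H.
by move=> l z Bz; have [_ _ _ H] := HF l; exact: H.
Qed.

End DressingTheorem.

(** * Permutability *)

Section Permutability.
Context {R : realType} {n : nat}.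
Local Notation C := (R[i]).
Local Notation M := ('M[R[i]]_n.+1).

Lemma conj_idem (f p : M) : f \in unitmx -> p * p = p ->
  (f *m p *m invmx f) * (f *m p *m invmx f) = f *m p *m invmx f.
Proof.
move=> uf pp; rewrite !mulmxE -!mulrA (mulrA (invmx f) f).
by rewrite -[invmx f * f]/(invmx f *m f) mulVmx // mul1r (mulrA p) pp.
Qed.

Lemma elt_root_proj (b1 b2 : C) (x : M) : x * x = x ->
  elt_root b1 b2 x * x = b1%:M * x.
Proof.
move=> xx; rewrite /elt_root mulrDl -scalerAl xx -!mulmxE !mul_scalar_mx.
by rewrite -scalerDl addrC subrK.
Qed.

Lemma elt_root_coproj (b1 b2 : C) (x : M) : x * x = x ->
  elt_root b1 b2 x * (1 - x) = b2%:M * (1 - x).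
Proof.
move=> xx; rewrite /elt_root mulrDl -scalerAl (mulrBr x) mulr1 xx subrr.
by rewrite scaler0 addr0.
Qed.

(** On the image of p, f is c times the value of lambda - Y at lambda = b1, and on
    its kernel c times the value at b2; so the relation between F and E carries
    the equations that characterize the projection moved by E over to its
    conjugate. The scalar c is 1 for the first simple element and -1 for the
    second one. *)
Lemma moved_conj (E F : R * R -> C -> M) (b1 b2 c : C) (p Y Yt f ft : M) z :
  p * p = p -> dressable E b1 b2 p z -> f \in unitmx -> ft \in unitmx ->
  let pt := moved_proj E b1 b2 p z in
  f = c *: (elt_root b1 b2 p - Y) -> ft = c *: (elt_root b1 b2 pt - Yt) ->
  (forall l, F z l * (l%:M - Yt) = (l%:M - Y) * E z l) ->
  dressable F b1 b2 (f *m p *m invmx f) z ->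
  moved_proj F b1 b2 (f *m p *m invmx f) z = ft *m pt *m invmx ft.
Proof.
move=> pp gE uf uft pt fE ftE FE gF.
have ptpt : pt * pt = pt := moved_proj_idem pp gE.
have fp : f * p = c *: ((b1%:M - Y) * p).
  by rewrite fE -scalerAl !mulrBl elt_root_proj.
have fp' : f * (1 - p) = c *: ((b2%:M - Y) * (1 - p)).
  by rewrite fE -scalerAl !mulrBl elt_root_coproj.
have ftp : ft * pt = c *: ((b1%:M - Yt) * pt).
  by rewrite ftE -scalerAl !mulrBl elt_root_proj.
have ftp' : ft * (1 - pt) = c *: ((b2%:M - Yt) * (1 - pt)).
  by rewrite ftE -scalerAl !mulrBl elt_root_coproj.
have img : E z b1 * pt = p * (E z b1 * pt).
  have := moved_proj_img pp gE; rewrite mulrBl mul1r mulrBl -mulrA => /eqP.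
  by rewrite subr_eq0 => /eqP.
have ker : E z b2 * (1 - pt) = (1 - p) * (E z b2 * (1 - pt)).
  have := moved_proj_ker pp gE; rewrite -/pt -mulrA => e.
  by rewrite [RHS]mulrBl mul1r e subr0.
have fV : invmx f * f = 1 by exact: mulVmx.
have ftV : ft * invmx ft = 1 by exact: mulmxV.
have e1 : F z b1 * (ft * pt) = f * p * (E z b1 * pt).
  rewrite ftp -scalerAr (mulrA (F z b1)) FE fp -scalerAl; congr (_ *: _).
  by rewrite -[LHS]mulrA {1}img -[RHS]mulrA.
have e2 : F z b2 * (ft * (1 - pt)) = f * (1 - p) * (E z b2 * (1 - pt)).
  rewrite ftp' -scalerAr (mulrA (F z b2)) FE fp' -scalerAl; congr (_ *: _).
  by rewrite -[LHS]mulrA {1}ker -[RHS]mulrA.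
apply: (moved_proj_unique (conj_idem uf pp) gF); rewrite !mulmxE.
  rewrite mulrA -(mulrA _ (F z b1)) e1 mulrA mulrA.
  have -> : (1 - f * p * invmx f) * (f * p) = 0.
    by rewrite mulrBl mul1r -!mulrA (mulrA (invmx f)) fV mul1r pp subrr.
  by rewrite !mul0r.
have -> : 1 - ft * pt * invmx ft = ft * (1 - pt) * invmx ft.
  by rewrite mulrBr mulr1 mulrBl ftV.
rewrite mulrA -(mulrA _ (F z b2)) e2 mulrA mulrA.
have -> : f * p * invmx f * (f * (1 - p)) = 0.
  rewrite -!mulrA (mulrA (invmx f)) fV mul1r mulrBr mulr1 pp subrr.
  by rewrite mulr0.
by rewrite !mul0r.
Qed.

(** Conjugation by f fixes f, the difference of the two elt_root, and fixes
    scalars. *)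
Lemma elt_root_exchange (al1 al2 be1 be2 : C) (x y : M) :
  let f := phi al1 al2 be1 be2 x y in f \in unitmx ->
  (be1 - be2) *: y + (al1 - al2) *: (f *m x *m invmx f) =
  (al1 - al2) *: x + (be1 - be2) *: (f *m y *m invmx f).
Proof.
move=> f uf.
have conjE c0 c1 (Z : M) : f *m (c0%:M + c1 *: Z) *m invmx f =
    c0%:M + c1 *: (f *m Z *m invmx f).
  rewrite mulmxDr mulmxDl -scalemxAr -scalemxAl; congr (_ + _).
  by rewrite scalar_mxC mulmxK.
have : (al2%:M + (al1 - al2) *: (f *m x *m invmx f)) -
    (be2%:M + (be1 - be2) *: (f *m y *m invmx f)) =
    (al2%:M + (al1 - al2) *: x) - (be2%:M + (be1 - be2) *: y).
  by rewrite -!conjE -mulmxBl -mulmxBr -[RHS](mulmxK uf).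
move: (al2%:M : M) (be2%:M : M) (_ *: (f *m x *m _)) (_ *: (f *m y *m _)) => A B x' y'.
move: (_ *: x) (_ *: y) => x0 y0.
rewrite !(opprD B) (addrACA A x') (addrACA A x0) => /addrI/eqP.
rewrite subr_eq => /eqP ->.
by rewrite addrA [y0 + _]addrC subrK.
Qed.

Lemma dress_eq a u E (b1 b2 : C) p z (Y : M) : moved_proj E b1 b2 p z = Y ->
  dress a E b1 b2 p u z = u z + (b1 - b2) *: lie a Y.
Proof. by rewrite /dress => ->. Qed.

Lemma addr_exchange {V : zmodType} (w s t s' t' : V) :
  s + t = s' + t' -> w + s + t = w + s' + t'.
Proof. by rewrite -!addrA => ->. Qed.

Lemma lie_exchange (a w x y x' y' : M) (c d : C) :
  d *: y + c *: x' = c *: x + d *: y' ->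
  w + d *: lie a y + c *: lie a x' = w + c *: lie a x + d *: lie a y'.
Proof.
have lieDZ (s t : C) (Y Z : M) : s *: lie a Y + t *: lie a Z = lie a (s *: Y + t *: Z).
  rewrite /lie mulmxDr mulmxDl -!scalemxAr -!scalemxAl !scalerBr.
  by rewrite opprD addrACA.
move=> e; apply: addr_exchange.
exact: (etrans (lieDZ d c y x') (etrans (congr1 (lie a) e) (esym (lieDZ c d x y')))).
Qed.

End Permutability.

Unset Implicit Arguments.

Theorem mainTheorem3 (R : realType) (n : nat)
  (a : 'M[R[i]]_n.+1) (ha_diag : is_diag_mx a) (ha_tr : \tr a = 0)
  (ha_neq0 : a != 0)
  (q : {poly R[i]}) (b : 'M[R[i]]_n.+1) (hb : b = horner_mx a q)
  (j : nat) (hj : (1 <= j)%N)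
  (Q : nat -> (nat -> 'M[R[i]]_n.+1) -> 'M[R[i]]_n.+1)
  (hQ : Q_sequence a b Q)
  (al1 al2 be1 be2 : R[i]) (p1 p2 : 'M[R[i]]_n.+1)
  (hp1 : p1 *m p1 = p1) (hp2 : p2 *m p2 = p2)
  (hphi : phi al1 al2 be1 be2 p1 p2 \in unitmx)
  (O : set (R * R)) (hO : open O) (hO0 : O (0, 0))
  (u : R * R -> 'M[R[i]]_n.+1) (hu : flow_solution a Q j O u)
  (E : R * R -> R[i] -> 'M[R[i]]_n.+1) (hE : trivialization a Q j O u E)
  (hm : exists (m : R * R -> R[i] -> 'M[R[i]]_n.+1) (P : set R[i])
               (mk : nat -> R * R -> 'M[R[i]]_n.+1),
          reduced_wave_function a b j O u E m P mk) :
  let phi0 := phi al1 al2 be1 be2 p1 p2 in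
  let tau1 := phi0 *m p1 *m invmx phi0 in
  let tau2 := phi0 *m p2 *m invmx phi0 in
  let p1t := moved_proj E al1 al2 p1 in
  let p2t := moved_proj E be1 be2 p2 in
  let u1 := dress a E al1 al2 p1 u in
  let u2 := dress a E be1 be2 p2 u in
  let phit := fun z => phi al1 al2 be1 be2 (p1t z) (p2t z) in
  let tau1t := fun z => phit z *m p1t z *m invmx (phit z) in
  let tau2t := fun z => phit z *m p2t z *m invmx (phit z) in
  exists r : R, 0 < r /\ ball ((0, 0) : R * R) r `<=` O /\
    (forall z, ball ((0, 0) : R * R) r z ->
       moved_transversal E al1 al2 p1 z /\ moved_transversal E be1 be2 p2 z /\
       phit z \in unitmx) /\
    exists E1 E2 : R * R -> R[i] -> 'M[R[i]]_n.+1,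
      trivialization a Q j (ball ((0, 0) : R * R) r) u1 E1 /\
      trivialization a Q j (ball ((0, 0) : R * R) r) u2 E2 /\
      forall z, ball ((0, 0) : R * R) r z ->
        moved_transversal E2 al1 al2 tau1 z /\ moved_transversal E1 be1 be2 tau2 z /\
        dress a E2 al1 al2 tau1 u2 z
          = u2 z + (al1 - al2) *: lie a (tau1t z) /\
        dress a E2 al1 al2 tau1 u2 z = dress a E1 be1 be2 tau2 u1 z /\
        dress a E1 be1 be2 tau2 u1 z
          = u1 z + (be1 - be2) *: lie a (tau2t z).
Proof.
move=> phi0 tau1 tau2 p1t p2t u1 u2 phit tau1t tau2t.
subst b; have su := flow_smooth hu; have pu := flow_perp hu.
have [r1 [r10 B1O gB1 [E1 [tE1 FE1]]]] :=
  dressing ha_diag hQ al1 al2 hO hO0 su pu hE hp1.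
have [r2 [r20 B2O gB2 [E2 [tE2 FE2]]]] :=
  dressing ha_diag hQ be1 be2 hO hO0 su pu hE hp2.
have oB1 : open (ball ((0, 0) : R * R) r1) by exact: ball_open.
have oB2 : open (ball ((0, 0) : R * R) r2) by exact: ball_open.
have B10 : ball ((0, 0) : R * R) r1 (0, 0) by exact: ballxx.
have B20 : ball ((0, 0) : R * R) r2 (0, 0) by exact: ballxx.
have phitE z : phit z = elt_root al1 al2 (p1t z) - elt_root be1 be2 (p2t z) by [].
have phi0E : phi0 = elt_root al1 al2 p1 - elt_root be1 be2 p2 by [].
pose A := ball ((0, 0) : R * R) r1 `&` ball ((0, 0) : R * R) r2.
have oA : open A by exact: openI.
have A0 : A (0, 0) by [].
have sE l : smooth_mx_on xt_dirs O (fun z => E z l) := triv_smooth hE l.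
have s1 : smooth_mx_on xt_dirs A p1t.
  apply: (smooth_moved_proj hp1 oA) => [z [/gB1]//|l].
  by apply: (smoothM_sub _ (sE l)) => z [/B1O].
have s2 : smooth_mx_on xt_dirs A p2t.
  apply: (smooth_moved_proj hp2 oA) => [z [_ /gB2]//|l].
  by apply: (smoothM_sub _ (sE l)) => z [/B1O].
have sphi : smooth_mx_on xt_dirs A phit.
  have c (Y : 'M[R[i]]_n.+1) := smoothM_cst Y oA.
  exact: (smoothMB oA (smoothMD oA (c _) (smoothMZl oA (al1 - al2) s1))
    (smoothMD oA (c _) (smoothMZl oA (be1 - be2) s2))).
have phi00 : phit (0, 0) = phi0.
  rewrite phitE phi0E.
  have -> : p1t (0, 0) = p1 := moved_proj_at0 hp1 hE (gB1 _ B10).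
  by have -> : p2t (0, 0) = p2 := moved_proj_at0 hp2 hE (gB2 _ B20).
have uphi0 : phit (0, 0) \in unitmx by rewrite phi00.
have n1 := near_unitmx oA sphi A0 uphi0.
have n2 := near_dressable al1 al2 tau1 oB2 B20 tE2.
have n3 := near_dressable be1 be2 tau2 oB1 B10 tE1.
have nA : \forall z \near ((0, 0) : R * R), A z by exact: open_nbhs_nbhs.
have [r [r0 rP]] := near0_ball (filterI (filterI nA n1) (filterI n2 n3)).
have rA z : ball ((0, 0) : R * R) r z -> A z by move=> /rP [[Az _] _].
have tE1' : trivialization a Q j (ball ((0, 0) : R * R) r) u1 E1.
  by apply: triv_sub tE1 => z /rA [].
have tE2' : trivialization a Q j (ball ((0, 0) : R * R) r) u2 E2.
  by apply: triv_sub tE2 => z /rA [].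
have rO : ball ((0, 0) : R * R) r `<=` O by move=> z /rA [/B1O].
exists r; split; first exact: r0.
split; first exact: rO.
split.
  move=> z Bz; have [[[Bz1 Bz2] uz] _] := rP z Bz.
  split; first exact: (dressable_transversal hp1 (gB1 _ Bz1)).
  by split; [exact: (dressable_transversal hp2 (gB2 _ Bz2))|exact: uz].
exists E1, E2; split; first exact: tE1'.
split; first exact: tE2'.
move=> z Bz; have [[[Bz1 Bz2] uz] [gg2 gg1]] := rP z Bz.
have P1 : moved_proj E2 al1 al2 tau1 z = tau1t z.
  apply: (moved_conj (c := 1) hp1 (gB1 _ Bz1) hphi uz _ _ (fun l => FE2 l z Bz2) gg2).
    by rewrite scale1r.
  by rewrite scale1r.
have P2 : moved_proj E1 be1 be2 tau2 z = tau2t z.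
  apply: (moved_conj (c := -1) hp2 (gB2 _ Bz2) hphi uz _ _ (fun l => FE1 l z Bz1) gg1).
    by rewrite scaleN1r opprB.
  by rewrite scaleN1r opprB.
have T1 := conj_idem hphi hp1; have T2 := conj_idem hphi hp2.
split; first exact: (dressable_transversal T1 gg2).
split; first exact: (dressable_transversal T2 gg1).
have d1 : dress a E2 al1 al2 tau1 u2 z =
    u2 z + (al1 - al2) *: lie a (tau1t z) := dress_eq a u2 P1.
have d2 : dress a E1 be1 be2 tau2 u1 z =
    u1 z + (be1 - be2) *: lie a (tau2t z) := dress_eq a u1 P2.
split; first exact: d1.
split; last exact: d2.
rewrite d1 d2; exact: (lie_exchange a (u z) (elt_root_exchange uz)).
Qed.
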